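(* Let $(M^n,g)$, $n\ge 2$, be a Riemannian manifold with scalar curvature $R$. Let $u_0,\dots,u_{n-2}$ be $C^3$ functions on $M$ satisfying $du_0\wedge\cdots\wedge du_{n-2}\neq0$, and let the associated vector fields $Z_m$ be defined by $$Z_m\,|Z_{m+1}|^{-1}=\nabla_{\Sigma_m}u_m,\qquad 0\le m\le n-2 .$$ Suppose that $|Z_{n-1}|=1$ and that $\operatorname{div}_{\Sigma_m}Z_m=0$ for all $0\le m\le n-2$. Then $$2\Delta|Z_0|\ \ge\ \frac{|\nabla Z_0|^2}{|Z_0|}+R\,|Z_0| .$$
   Context: For $0\le m\le n-2$, $\Sigma_m$ denotes the joint level sets of the map $(u_0,\dots,u_{m-1})$, with $\Sigma_0=M$; through each point passes exactly one such level set, locally an $(n-m)$-dimensional submanifold with the induced metric. $\nabla_{\Sigma_m}f$ denotes the gradient, at each point on the level set $\Sigma_m$ through it, of the restriction of $f$, and $\operatorname{div}_{\Sigma_m}$ the divergence on $\Sigma_m$ of a vector field tangent to the level sets $\Sigma_m$. Thus $\nabla_{\Sigma_m}u_m$ is the orthogonal projection of $\nabla u_m$ onto the orthogonal complement of $\nabla u_0,\dots,\nabla u_{m-1}$. The vector field $Z_{n-1}$ enters only through its length, so with $|Z_{n-1}|=1$ the fields $Z_{n-2},\dots,Z_0$ are determined by the $u_m$: $Z_{n-2}=\nabla_{\Sigma_{n-2}}u_{n-2}$ and $Z_m=|Z_{m+1}|\nabla_{\Sigma_m}u_m$. $\nabla$ and $\Delta$ are the Levi-Civita connection and Laplacian of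 $(M,g)$. *)

(* Defs.v *)
From HB Require Import structures.
From mathcomp Require Import all_boot all_order all_algebra.
From mathcomp Require Import all_classical all_reals all_analysis.
Import Order.TTheory GRing.Theory Num.Theory.
Import numFieldNormedType.Exports.

Set Implicit Arguments.
Unset Strict Implicit.
Unset Printing Implicit Defensive.

Local Open Scope classical_set_scope.
Local Open Scope ring_scope.

(* Tangent vectors in a chart are row vectors 'rV_n of components.
   A linear map v |-> v *m N is written as a matrix acting on the right. *)

Section Coordinates.
Context {R : realType} {n : nat}.
Implicit Types (U : set 'rV[R]_n) (f : 'rV[R]_n -> R) (x : 'rV[R]_n).

Definition pd (i : 'I_n) f : 'rV[R]_n -> R := fun x => 'D_(delta_mx 0 i) f x.

(* meant for open U *)
Fixpoint Ck (k : nat) U f : Prop :=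
  match k with
  | 0%N => forall x, U x -> {for x, continuous f}
  | k'.+1 => (forall x, U x -> differentiable f x) /\
             (forall i, Ck k' U (pd i f))
  end.

Definition smooth U f : Prop := forall k, Ck k U f.

(* components of df *)
Definition dform f x : 'rV[R]_n := \row_k pd k f x.

(* The exterior product of the covectors given by the rows of A, evaluated on
   the vectors given by the rows of V. *)
Definition wedge (k : nat) (A V : 'M[R]_(k, n)) : R := \det (A *m V^T).

Definition vnorm (G : 'M[R]_n) (v : 'rV[R]_n) : R :=
  Num.sqrt ((v *m G *m v^T) 0 0).

(* From here on g is the matrix (g_ij) of a metric in a coordinate domain. *)
Implicit Types (g : 'rV[R]_n -> 'M[R]_n) (X : 'rV[R]_n -> 'rV[R]_n).

Definition grad g f x : 'rV[R]_n := dform f x *m invmx (g x).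

(* Gamma^k_ij *)
Definition christoffel g (k i j : 'I_n) x : R :=
  2^-1 * \sum_l invmx (g x) k l *
    (pd i (fun y => g y j l) x + pd j (fun y => g y i l) x
     - pd l (fun y => g y i j) x).

(* Entry (i, k) is the k-th component of nabla_{d_i} X, so that the
   covariant derivative of X in the direction v is v *m nabla g X x. *)
Definition nabla g X x : 'M[R]_n :=
  \matrix_(i, k) (pd i (fun y => X y 0 k) x
                  + \sum_j christoffel g k i j x * X x 0 j).

Definition laplacian g f x : R :=
  \sum_i \sum_j invmx (g x) i j *
    (pd i (pd j f) x - \sum_k christoffel g k i j x * pd k f x).

Definition ricci g (i j : 'I_n) x : R :=
  \sum_k (pd k (christoffel g k i j) x - pd j (christoffel g k i k) x
    + \sum_l (christoffel g k k l x * christoffel g l i j x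
              - christoffel g k j l x * christoffel g l i k x)).

(* normalized to be n (n - 1) on the unit n-sphere *)
Definition scalar_curvature g x : R :=
  \sum_i \sum_j invmx (g x) i j * ricci g i j x.

(* g^ij g_kl N_i^k N_j^l *)
Definition sqnorm11 (G N : 'M[R]_n) : R := \tr (invmx G *m N *m G *m N^T).

(* The level sets Sigma_m of (u_0, ..., u_(m-1)). *)

Definition dU (u : nat -> 'rV[R]_n -> R) (m : nat) x : 'M[R]_(m, n) :=
  \matrix_(j < m) dform (u j) x.

(* The row space is the tangent space of Sigma_m, the common kernel of
   du_0, ..., du_(m-1). *)
Definition tangentS u m x : 'M[R]_n := kermx (dU u m x)^T.

(* The row space is spanned by the gradients of u_0, ..., u_(m-1). *)
Definition normalS g u m x : 'M[R]_n := (<<dU u m x *m invmx (g x)>>)%MS.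

Definition projS g u m x : 'M[R]_n := proj_mx (tangentS u m x) (normalS g u m x).

Definition gradS g u m f x : 'rV[R]_n := grad g f x *m projS g u m x.

(* The Levi-Civita connection of Sigma_m with the induced metric: for v tangent
   and X tangential, it is the tangential part v *m nablaS g u m X x of the
   derivative of X in the direction v. *)
Definition nablaS g u m X x : 'M[R]_n := nabla g X x *m projS g u m x.

(* Divergence on Sigma_m of a tangential field X: the trace of the endomorphism
   v |-> v *m nablaS g u m X x of the tangent space of Sigma_m. Precomposing
   with the projection extends it by 0 on the normal space. *)
Definition divS g u m X x : R := \tr (projS g u m x *m nablaS g u m X x).

End Coordinates.

Record chart (R : realType) (n : nat) (M : topologicalType) := Chart {
  dom : set M;
  cod : set 'rV[R]_n;
  phi : M -> 'rV[R]_n;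
  psi : 'rV[R]_n -> M;
  open_dom : open dom;
  open_cod : open cod;
  phi_cod : forall p, dom p -> cod (phi p);
  psi_dom : forall x, cod x -> dom (psi x);
  phiK : forall p, dom p -> psi (phi p) = p;
  psiK : forall x, cod x -> phi (psi x) = x;
  phi_continuous : forall p, dom p -> {for p, continuous phi};
  psi_continuous : forall x, cod x -> {for x, continuous psi} }.

Definition overlap (R : realType) (n : nat) (M : topologicalType)
    (c d : chart R n M) : set 'rV[R]_n :=
  [set x | cod c x /\ dom d (psi c x)].

Definition transition (R : realType) (n : nat) (M : topologicalType)
    (c d : chart R n M) : 'rV[R]_n -> 'rV[R]_n :=
  fun x => phi d (psi c x).

Record manifold (R : realType) (n : nat) := Manifold {
  carrier :> topologicalType;
  manifold_hausdorff : hausdorff_space carrier;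
  manifold_second_countable : @second_countable carrier;
  chart_index : Type;
  atlas : chart_index -> chart R n carrier;
  atlas_cover : forall p : carrier, exists a, dom (atlas a) p;
  atlas_smooth : forall a b (k : 'I_n),
    smooth (overlap (atlas a) (atlas b))
           (fun x => transition (atlas a) (atlas b) x 0 k) }.

Definition in_chart (R : realType) (n : nat) (M : manifold R n)
    (a : chart_index M) (f : M -> R) : 'rV[R]_n -> R :=
  fun x => f (psi (atlas a) x).

Definition CkM (R : realType) (n : nat) (M : manifold R n) (k : nat)
    (f : M -> R) : Prop :=
  forall a, Ck k (cod (atlas a)) (in_chart a f).

Record metric (R : realType) (n : nat) (M : manifold R n) := Metric {
  gmx :> chart_index M -> 'rV[R]_n -> 'M[R]_n;
  gmx_smooth : forall a i j,
    smooth (cod (atlas a)) (fun x => gmx a x i j);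
  gmx_sym : forall a x, cod (atlas a) x -> (gmx a x)^T = gmx a x;
  gmx_pos : forall a x (v : 'rV[R]_n), cod (atlas a) x -> v != 0 ->
    0 < (v *m gmx a x *m v^T) 0 0;
  gmx_transition : forall a b x, overlap (atlas a) (atlas b) x ->
    let tau := transition (atlas a) (atlas b) in
    gmx a x = 'J tau x *m gmx b (tau x) *m ('J tau x)^T }.

(* vector fields, with no regularity imposed *)
Record vector_field (R : realType) (n : nat) (M : manifold R n) := VectorField {
  vcomp :> chart_index M -> 'rV[R]_n -> 'rV[R]_n;
  vcomp_transition : forall a b x, overlap (atlas a) (atlas b) x ->
    let tau := transition (atlas a) (atlas b) in
    vcomp b (tau x) = vcomp a x *m 'J tau x }.

(* Main.v *)
Require Import Defs.
From HB Require Import structures.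
From mathcomp Require Import all_boot all_order all_algebra.
From mathcomp Require Import all_classical all_reals all_analysis.
From mathcomp Require Import ring lra.
Import Order.TTheory GRing.Theory Num.Theory.
Import numFieldNormedType.Exports.
Set Implicit Arguments.
Unset Strict Implicit.
Unset Printing Implicit Defensive.
Local Open Scope classical_set_scope.
Local Open Scope ring_scope.

(** Let [e_0, ..., e_{n-1}] be the orthonormal frame that Gram-Schmidt makes
    from the gradients of u_0, ..., u_{n-2} and of one further function, a
    coordinate of the chart.  Then Z_m = w_m e_m, where w_m is the product of
    the lengths of grad_{Sigma_k} u_k over m <= k <= n-2.  Write
    om_ijk = <nabla_{e_i} e_j, e_k>, which is skew in (j, k), and
    A_i = sum_k om_kki.

    The brackets of e_{m+1}, ..., e_{n-1} are tangent to the level sets of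
    (u_0, ..., u_m), so om_ijm = om_jim for i, j > m ([conn_flag]); the same
    argument gives e_i log |grad_{Sigma_m} u_m| = om_mmi for i > m
    ([dd_grad_len]).  Combined with div_{Sigma_m} Z_m = 0, a descending
    induction on m yields e_i w_m = w_m sum_{k >= m} om_kki for i >= m
    ([dd_weight]).  For m = 0 and w = |Z_0| this reads e_i w = w A_i: not only
    Z_0 = w e_0 but every field w e_i is divergence free.

    Each e_k satisfies the Bochner identity
    div (nabla_X X) - X (div X) = Ric (X, X) + tr ((nabla X)^2) ([bochner]).
    Since sum_k nabla_{e_k} e_k = sum_i A_i e_i and div e_k = - A_k, the sum
    over k is 2 sum_i e_i A_i - |A|^2 = R + S with S = sum_ijk om_ijk om_jik
    ([scalar_curvature_frame]).  From e_i w = w A_i one gets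
    laplacian w = w sum_i e_i A_i, hence 2 laplacian w = w (R + S + |A|^2)
    ([laplacian_weight]), whereas
    |nabla (w e_0)|^2 = w^2 (|A|^2 + sum_ik om_i0k^2).  The inequality is thus
    S >= sum_ik om_i0k^2.  Sorting the terms of S by their smallest index, the
    symmetry om_ijm = om_jim makes S a sum of squares ([flag_sum_of_squares]),
    and those with smallest index 0 are exactly the right-hand side
    ([flag_sum_ge]). *)

(** * Symmetry of second derivatives *)

Section DirectionalCalculus.
Context {R : realType} {V : normedModType R}.
Implicit Types (f g : V -> R) (x v w : V).

Lemma near_eq_differentiable f g x :
  {near x, f =1 g} -> differentiable f x -> differentiable g x.
Proof.
move=> fg df.
have fgx : f x = g x by exact: nbhs_singleton fg.
have fg0 : \forall h \near (0 : V), f (h + x) = g (h + x).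
  by move: fg; rewrite (near_shift 0 x) subr0.
have gE : g \o shift x = cst (g x) + 'd f x +o_ 0 id.
  apply/eqaddoP => e e0.
  have /eqaddoP/(_ e e0) := diff_locally df.
  apply: filterS2 fg0 => h.
  by rewrite -[(g \o _ - _) h]/(g (h + x) - (g x + 'd f x h)) -fgx => <-.
have dgE := diff_unique (diff_continuous df) gE.
by apply/diff_locallyP; rewrite dgE; split=> //; exact: diff_continuous.
Qed.

Lemma line_mvt f x v (h : R) : 0 < h ->
  (forall r, 0 <= r <= h -> differentiable f (x + r *: v)) ->
  exists2 c, 0 < c < h & f (x + h *: v) - f x = h * 'D_v f (x + c *: v).
Proof.
move=> h0 df.
pose F (r : R) := f (x + r *: v).
have dF r : 0 <= r <= h -> is_derive r 1 F ('D_v f (x + r *: v)).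
  move=> rh; have dfr := df r rh.
  have dl : is_diff r (fun s : R => x + s *: v) (fun s => s *: v).
    have dc : is_diff r (cst x + ( *:%R^~ v) : R -> V) (0 + ( *:%R^~ v)).
      exact: is_diffD.
    by rewrite add0r in dc.
  have dFr : differentiable F r by apply: differentiable_comp => //; exact: ex_diff.
  split; first exact: diff_derivable.
  rewrite deriveE // /F (@diff_comp _ _ _ _ (fun s : R => x + s *: v) f) //.
    by rewrite /= diff_val scale1r deriveE.
have [||c /[!in_itv]/= ch E] := @MVT R F (fun r => 'D_v f (x + r *: v)) 0 h h0.
- by move=> r /[!in_itv]/= /andP[r0 rh]; apply: dF; rewrite !ltW.
- apply/continuous_in_subspaceT => r /[!inE]/= /[!in_itv]/= rh.
  apply: differentiable_continuous; apply/derivable1_diffP.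
  by have [] := dF r rh.
exists c => //; move: E; rewrite /F scale0r addr0 subr0 => ->.
by rewrite mulrC.
Qed.

Lemma differentiable_shift f x v :
  differentiable f (x + v) -> differentiable (fun y => f (y + v)) x.
Proof.
by move=> df; apply: (@differentiable_comp _ _ _ _ (fun y => y + v) f).
Qed.

Lemma derive_shift_arg f x v w :
  'D_w (fun y => f (y + v)) x = 'D_w f (x + v).
Proof.
rewrite /derive; set F := (X in lim (X @ _)); set G := (X in _ = lim (X @ _)).
by suff -> : F = G by []; apply/funext => h; rewrite /F /G /= addrA.
Qed.

(** The mean value theorem is applied to [y |-> f (y + h w) - f y] along [v],
    and then to ['D_v f] along [w]. *)
Lemma second_difference_mvt f x v w (h : R) : 0 < h ->
  (forall r s, 0 <= r <= h -> 0 <= s <= h ->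
     differentiable f (x + r *: v + s *: w) /\
     differentiable ('D_v f) (x + r *: v + s *: w)) ->
  exists c d, [/\ 0 < c < h, 0 < d < h &
    f (x + h *: v + h *: w) - f (x + h *: v) - f (x + h *: w) + f x =
    h * (h * 'D_w ('D_v f) (x + c *: v + d *: w))].
Proof.
move=> h0 df.
have hh : 0 <= h <= h by rewrite lexx ltW.
have h00 : 0 <= (0 : R) <= h by rewrite lexx ltW.
pose F y := f (y + h *: w) - f y.
have dF1 r : 0 <= r <= h -> differentiable (fun y => f (y + h *: w)) (x + r *: v).
  by move=> rh; apply: differentiable_shift; have [] := df r h rh hh.
have dF2 r : 0 <= r <= h -> differentiable f (x + r *: v).
  by move=> rh; have [] := df r 0 rh h00; rewrite scale0r addr0.
have [|c ch E1] := @line_mvt F x v h h0.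
  by move=> r rh; apply: differentiableB; [exact: dF1|exact: dF2].
have cI : 0 <= c <= h by case/andP: ch => c0 c1; rewrite !ltW.
have [|d dh E2] := @line_mvt ('D_v f) (x + c *: v) w h h0.
  by move=> r rh; have [] := df c r cI rh.
exists c, d; split => //.
transitivity (F (x + h *: v) - F x); first by rewrite /F; ring.
rewrite E1 deriveB; last 2 first.
- exact/diff_derivable/dF1.
- exact/diff_derivable/dF2.
by rewrite derive_shift_arg E2.
Qed.

Lemma near_parallelogram x v w (P : V -> Prop) :
  (\near x, P x) -> exists2 h : R, 0 < h &
  forall r s, 0 <= r <= h -> 0 <= s <= h -> P (x + r *: v + s *: w).
Proof.
move=> /nbhs_ballP[e /= e0 eP].
have N0 : 0 < `|v| + `|w| + 1 by rewrite ltr_wpDl.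
exists (e / (`|v| + `|w| + 1)); first by rewrite divr_gt0.
move=> r s /andP[r0 rh] /andP[s0 sh]; apply: eP.
rewrite -ball_normE /= -addrA opprD addNKr normrN.
rewrite (le_lt_trans (ler_normD _ _))// !normrZ !ger0_norm//.
have le1 : r * `|v| + s * `|w| <= e / (`|v| + `|w| + 1) * (`|v| + `|w|).
  by rewrite mulrDr lerD // ler_wpM2r.
by rewrite (le_lt_trans le1)// -mulrA gtr_pMr// mulrC ltr_pdivrMr// mul1r ltrDl.
Qed.

(** Schwarz's theorem. The second difference along [v] and [w] is symmetric in
    [v] and [w], and it is [h ^+ 2] times either mixed derivative at points
    that tend to [x] with [h]. *)
Lemma derive_comm f x v w :
  (\near x, differentiable f x /\
     differentiable ('D_v f) x /\ differentiable ('D_w f) x) ->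
  {for x, continuous ('D_w ('D_v f))} -> {for x, continuous ('D_v ('D_w f))} ->
  'D_w ('D_v f) x = 'D_v ('D_w f) x.
Proof.
move=> df cwv cvw; apply/eqP; rewrite -subr_eq0 -normr_le0.
apply/ler_addgt0Pl => e e0; rewrite addr0.
have e20 : 0 < e / 2 by rewrite divr_gt0.
have nearwv : \forall y \near x, `|'D_w ('D_v f) x - 'D_w ('D_v f) y| < e / 2.
  by move/cvgrPdist_lt : cwv => /(_ _ e20).
have nearvw : \forall y \near x, `|'D_v ('D_w f) x - 'D_v ('D_w f) y| < e / 2.
  by move/cvgrPdist_lt : cvw => /(_ _ e20).
have [h h0 Ph] := near_parallelogram v w
  (filterI df (filterI nearwv nearvw)).
have [|c [d [ch dh E1]]] := @second_difference_mvt f x v w h h0.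
  by move=> r s rh sh; have [[? [? ?]] _] := Ph r s rh sh.
have [|d' [c' [dh' ch' E2]]] := @second_difference_mvt f x w v h h0.
  move=> r s rh sh; have [[? [? ?]] _] := Ph s r sh rh.
  by rewrite (addrAC x (r *: w) (s *: v)).
have EE : 'D_w ('D_v f) (x + c *: v + d *: w) =
          'D_v ('D_w f) (x + d' *: w + c' *: v).
  have hn0 : h != 0 by rewrite gt_eqF.
  have sh := addrAC x (h *: w) (h *: v).
  apply: (mulfI hn0); apply: (mulfI hn0).
  apply: etrans (esym E1) _; apply: etrans _ E2; rewrite sh.
  by congr (_ + _); exact: addrAC.
have ltW2 (r : R) : 0 < r < h -> 0 <= r <= h.
  by case/andP => ? ?; rewrite !ltW.
have [_ [near_wv _]] := Ph c d (ltW2 _ ch) (ltW2 _ dh).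
have [_ [_ near_vw]] := Ph c' d' (ltW2 _ ch') (ltW2 _ dh').
rewrite EE in near_wv; rewrite (addrAC x (c' *: v) (d' *: w)) in near_vw.
move: near_wv near_vw.
move: ('D_w _ x) ('D_v ('D_w f) x) ('D_v _ _) => a b p ap bp.
have -> : a - b = (a - p) - (b - p) by ring.
apply: (le_trans (ler_normB _ _)); rewrite (splitr e).
by apply: lerD; exact: ltW.
Qed.

End DirectionalCalculus.

(** * Functions of class C^k in a chart *)

Section Ck.
Context {R : realType} {n : nat}.
Implicit Types (U W : set 'rV[R]_n) (f g : 'rV[R]_n -> R) (x : 'rV[R]_n).

Lemma open_near U x (P : 'rV[R]_n -> Prop) :
  open U -> U x -> (forall y, U y -> P y) -> \near x, P x.
Proof. by move=> oU Ux UP; apply: filterS (open_nbhs_nbhs (conj oU Ux)). Qed.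

Lemma eq_pd U f g i x : open U -> (forall y, U y -> f y = g y) -> U x ->
  pd i f x = pd i g x.
Proof. by move=> oU fg Ux; apply: near_eq_derive; exact: open_near fg. Qed.

Lemma eq_Ck k U f g : open U -> (forall y, U y -> f y = g y) ->
  Ck k U f -> Ck k U g.
Proof.
move=> oU; elim: k f g => [|k IH] f g fg /=.
  move=> cf x Ux; have fgx := fg x Ux.
  have nfg : \forall y \near x, f y = g y by exact: open_near fg.
  rewrite /prop_for /continuous_at -fgx.
  by apply: cvg_trans (cf x Ux); exact: (@near_eq_cvg _ _ (nbhs x)).
move=> [df dfk]; split=> [x Ux|i].
  by apply: near_eq_differentiable (df x Ux); exact: open_near fg.
by apply: IH (dfk i) => x Ux; exact: eq_pd fg Ux.
Qed.

Lemma Ck_pred k U f : Ck k.+1 U f -> Ck k U f.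
Proof.
elim: k f => [|k IH] f [df dfk].
  by move=> x Ux; apply: differentiable_continuous; exact: df.
by split=> // i; apply: IH; exact: dfk.
Qed.

Lemma Ck_le k l U f : (k <= l)%N -> Ck l U f -> Ck k U f.
Proof.
elim: l => [|l IH]; first by rewrite leqn0 => /eqP ->.
by rewrite leq_eqVlt => /orP[/eqP ->//|kl /Ck_pred]; exact: IH.
Qed.

Lemma Ck_subset k U W f : W `<=` U -> Ck k U f -> Ck k W f.
Proof.
move=> WU; elim: k f => [|k IH] f /=; first by move=> cf x /WU; exact: cf.
by move=> [df dfk]; split=> [x /WU|i]; [exact: df|apply: IH; exact: dfk].
Qed.

Lemma Ck_pd k U f i : Ck k.+1 U f -> Ck k U (pd i f).
Proof. by move=> [_]; exact. Qed.

Lemma Ck1_differentiable k U f x :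
  (0 < k)%N -> Ck k U f -> U x -> differentiable f x.
Proof. by case: k => // k _ [df _]; exact: df. Qed.

Lemma Ck_cst k U (c : R) : open U -> Ck k U (fun=> c).
Proof.
move=> oU; elim: k c => [|k IH] c /=; first by move=> x _; exact: cst_continuous.
split=> [x _|i]; first exact: differentiable_cst.
apply: eq_Ck (IH 0) => // x _; rewrite /pd.
exact/esym/(@derive_cst _ _ _ c).
Qed.

Lemma pd_cst i (c : R) x : pd i (fun=> c) x = 0.
Proof. exact: (@derive_cst _ _ _ c). Qed.

Lemma pdD i f g x : differentiable f x -> differentiable g x ->
  pd i (fun y => f y + g y) x = pd i f x + pd i g x.
Proof. by move=> df dg; apply: deriveD; exact: diff_derivable. Qed.

Lemma pdM i f g x : differentiable f x -> differentiable g x ->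
  pd i (fun y => f y * g y) x = pd i f x * g x + f x * pd i g x.
Proof.
move=> df dg; rewrite /pd (@deriveM _ _ f g); [|exact: diff_derivable..].
by rewrite addrC /GRing.scale /= [g x * _]mulrC.
Qed.

Lemma differentiable_bigsum (I : Type) (r : seq I)
    (F : I -> 'rV[R]_n -> R) x :
  (forall j, differentiable (F j) x) ->
  differentiable (fun y => \sum_(j <- r) F j y) x.
Proof.
move=> dF; elim: r => [|k r IH].
  rewrite (_ : (fun y => _) = cst 0); first exact: differentiable_cst.
  by apply/funext => y; rewrite big_nil.
rewrite (_ : (fun y => _) = F k + (fun y => \sum_(j <- r) F j y)).
  exact: differentiableD.
by apply/funext => y; rewrite big_cons.
Qed.

Lemma pd_sum i (I : Type) (r : seq I) (F : I -> 'rV[R]_n -> R) x :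
  (forall j, differentiable (F j) x) ->
  pd i (fun y => \sum_(j <- r) F j y) x = \sum_(j <- r) pd i (F j) x.
Proof.
move=> dF; elim: r => [|j r IH].
  rewrite big_nil -[RHS](pd_cst i 0 x); congr (pd i _ x).
  by apply/funext => y; rewrite big_nil.
rewrite big_cons -IH -pdD //; last exact: differentiable_bigsum.
by congr (pd i _ x); apply/funext => y; rewrite big_cons.
Qed.

Lemma Ck_add k U f g : open U -> Ck k U f -> Ck k U g ->
  Ck k U (fun x => f x + g x).
Proof.
move=> oU; elim: k f g => [|k IH] f g /=.
  by move=> cf cg x Ux; apply: continuousD; [exact: cf|exact: cg].
move=> [df fk] [dg gk]; split=> [x Ux|i].
  by apply: differentiableD; [exact: df|exact: dg].
apply: eq_Ck (IH _ _ (fk i) (gk i)) => // x Ux.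
by rewrite pdD //; [exact: df|exact: dg].
Qed.

Lemma Ck_mul k U f g : open U -> Ck k U f -> Ck k U g ->
  Ck k U (fun x => f x * g x).
Proof.
move=> oU; elim: k f g => [|k IH] f g.
  by move=> cf cg x Ux; apply: continuousM; [exact: cf|exact: cg].
move=> fC gC; have [df fk] := fC; have [dg gk] := gC; split=> [x Ux|i].
  by apply: differentiableM; [exact: df|exact: dg].
apply: (@eq_Ck _ _ (fun x => pd i f x * g x + f x * pd i g x)) => //.
  by move=> x Ux; rewrite pdM //; [exact: df|exact: dg].
apply: Ck_add => //.
  by apply: IH; [exact: fk|exact: Ck_pred].
by apply: IH; [exact: Ck_pred|exact: gk].
Qed.

Lemma Ck_scale k U f (c : R) : open U -> Ck k U f -> Ck k U (fun x => c * f x).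
Proof. by move=> oU; apply: Ck_mul => //; exact: Ck_cst. Qed.

Lemma Ck_opp k U f : open U -> Ck k U f -> Ck k U (fun x => - f x).
Proof.
move=> oU fC; by apply: eq_Ck (Ck_scale (-1) oU fC) => // x _; rewrite mulN1r.
Qed.

Lemma Ck_sub k U f g : open U -> Ck k U f -> Ck k U g ->
  Ck k U (fun x => f x - g x).
Proof. by move=> oU fC gC; apply: Ck_add => //; exact: Ck_opp. Qed.

Lemma Ck_sum k U (I : Type) (r : seq I) (P : pred I) (F : I -> 'rV[R]_n -> R) :
  open U -> (forall j, P j -> Ck k U (F j)) ->
  Ck k U (fun x => \sum_(j <- r | P j) F j x).
Proof.
move=> oU FC; elim: r => [|j r IH].
  by apply: eq_Ck (Ck_cst k 0 oU) => // x _; rewrite big_nil.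
have [Pj|Pj] := boolP (P j); last first.
  by apply: eq_Ck IH => // x _; rewrite big_cons (negbTE Pj).
by apply: eq_Ck (Ck_add oU (FC j Pj) IH) => // x _; rewrite big_cons Pj.
Qed.

Lemma Ck_prod k U (I : Type) (r : seq I) (P : pred I) (F : I -> 'rV[R]_n -> R) :
  open U -> (forall j, P j -> Ck k U (F j)) ->
  Ck k U (fun x => \prod_(j <- r | P j) F j x).
Proof.
move=> oU FC; elim: r => [|j r IH].
  by apply: eq_Ck (Ck_cst k 1 oU) => // x _; rewrite big_nil.
have [Pj|Pj] := boolP (P j); last first.
  by apply: eq_Ck IH => // x _; rewrite big_cons (negbTE Pj).
by apply: eq_Ck (Ck_mul oU (FC j Pj) IH) => // x _; rewrite big_cons Pj.
Qed.

Lemma Ck_inv k U f : open U -> (forall x, U x -> f x != 0) -> Ck k U f ->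
  Ck k U (fun x => (f x)^-1).
Proof.
move=> oU f0; elim: k => [|k IH] fC.
  by move=> x Ux; apply: continuousV; [exact: f0|exact: fC].
have [df fk] := fC; split=> [x Ux|i].
  by apply: differentiableV; [exact: df|exact: f0].
have VC := IH (Ck_pred fC).
apply: eq_Ck (Ck_opp oU (Ck_mul oU (fk i) (Ck_mul oU VC VC))) => // x Ux.
rewrite /pd deriveV; [|exact: f0|exact/diff_derivable/df].
by rewrite /GRing.scale /= expr2 invfM; ring.
Qed.

Lemma Ck_sqrt k U f : open U -> (forall x, U x -> 0 < f x) -> Ck k U f ->
  Ck k U (fun x => Num.sqrt (f x)).
Proof.
move=> oU f0; elim: k => [|k IH] fC.
  move=> x Ux; apply: (@continuous_comp _ _ _ f Num.sqrt); first exact: fC.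
  exact: sqrt_continuous.
have [df fk] := fC.
have sC := IH (Ck_pred fC).
have s0 x : U x -> 2 * Num.sqrt (f x) != 0.
  by move=> Ux; rewrite mulf_neq0 ?pnatr_eq0// sqrtr_eq0 -ltNge f0.
have sdiff x : U x -> differentiable Num.sqrt (f x).
  by move=> Ux; apply/derivable1_diffP; have [] := is_derive1_sqrt (f0 x Ux).
split=> [x Ux|i].
  by apply: differentiable_comp; [exact: df|exact: sdiff].
apply: eq_Ck (Ck_mul oU (fk i) (Ck_inv oU s0 (Ck_scale 2 oU sC))) => // x Ux.
have dfx := df x Ux; have dsx := sdiff x Ux.
rewrite /pd [RHS]deriveE; last exact: differentiable_comp.
rewrite (@diff_comp _ _ _ _ f Num.sqrt) //= diff1E //=.
by rewrite derive1E derive_sqrt ?f0 // [in RHS]/GRing.scale /= deriveE.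
Qed.

Lemma Ck_mx_det k U m (A : 'rV[R]_n -> 'M[R]_m) : open U ->
  (forall i j, Ck k U (fun x => A x i j)) -> Ck k U (fun x => \det (A x)).
Proof.
move=> oU AC; apply: Ck_sum => // s _; apply: Ck_mul; [done|exact: Ck_cst|].
by apply: Ck_prod => // i _; exact: AC.
Qed.

Lemma Ck_mulmx k U m p q (A : 'rV[R]_n -> 'M[R]_(m, p))
    (B : 'rV[R]_n -> 'M[R]_(p, q)) : open U ->
  (forall i j, Ck k U (fun x => A x i j)) ->
  (forall i j, Ck k U (fun x => B x i j)) ->
  forall i j, Ck k U (fun x => (A x *m B x) i j).
Proof.
move=> oU AC BC i j.
apply: (@eq_Ck _ _ (fun x => \sum_l A x i l * B x l j)) => //.
  by move=> x _; rewrite mxE.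
by apply: Ck_sum => // l _; exact: Ck_mul.
Qed.

Lemma Ck_invmx k U m (A : 'rV[R]_n -> 'M[R]_m) : open U ->
  (forall x, U x -> A x \in unitmx) ->
  (forall i j, Ck k U (fun x => A x i j)) ->
  forall i j, Ck k U (fun x => invmx (A x) i j).
Proof.
move=> oU Au AC i j.
apply: (@eq_Ck _ _ (fun x => (\det (A x))^-1 * cofactor (A x) j i)) => //.
  by move=> x Ux; rewrite /invmx (Au _ Ux) !mxE.
apply: Ck_mul => //.
  apply: Ck_inv => //; last exact: Ck_mx_det.
  by move=> x Ux; have := Au x Ux; rewrite unitmxE unitfE.
apply: Ck_mul => //; first exact: Ck_cst.
apply: Ck_mx_det => // a b.
by apply: eq_Ck (AC (lift j a) (lift i b)) => // x _; rewrite !mxE.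
Qed.

Lemma pd_comm U f i j x : open U -> Ck 2 U f -> U x ->
  pd i (pd j f) x = pd j (pd i f) x.
Proof.
move=> oU [df fk] Ux; apply: derive_comm.
- apply: (open_near oU Ux) => y Uy; split; first exact: df.
  by have [/(_ y Uy) ? _] := fk j; have [/(_ y Uy) ? _] := fk i.
- by have [_ /(_ i)] := fk j; exact.
- by have [_ /(_ j)] := fk i; exact.
Qed.

End Ck.

Arguments Ck : simpl never.

(** * The Bochner identity in coordinates *)

(** The values at one point of the components of a field X, of its first and
    second derivatives, of symmetric Christoffel symbols C and of their
    derivatives; N is then nabla X and dN its derivative. *)
Section BochnerAlgebra.
Context {R : comNzRingType} {n : nat}.
Variables (X : 'I_n -> R) (dX : 'I_n -> 'I_n -> R)
  (ddX : 'I_n -> 'I_n -> 'I_n -> R) (C : 'I_n -> 'I_n -> 'I_n -> R)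
  (dC : 'I_n -> 'I_n -> 'I_n -> 'I_n -> R).
Hypothesis ddX_sym : forall a b k, ddX a b k = ddX b a k.
Hypothesis C_sym : forall k a b, C k a b = C k b a.
Hypothesis dC_sym : forall l k a b, dC l k a b = dC l k b a.

Let N a k := dX a k + \sum_j C k a j * X j.
Let dN l a k := ddX l a k + \sum_j (dC l k a j * X j + C k a j * dX l j).
Let Ric a b := \sum_i (dC i i a b - dC b i a i
  + \sum_l (C i i l * C l a b - C i b l * C l a i)).

(* The commutator of the two second covariant derivatives of X, before
   contraction with X: the terms in dX cancel by the symmetry of C. *)
Let commutator j :
  (\sum_i dN i j i + \sum_i \sum_l C i i l * N j l)
  - (\sum_i dN j i i + \sum_i \sum_l C l i j * N l i) =
  \sum_k X k * Ric k j.
Proof.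
have E1 : \sum_i dN i j i = \sum_i ddX i j i
    + (\sum_i \sum_k dC i i j k * X k + \sum_i \sum_k C i j k * dX i k).
  by rewrite -!big_split; apply: eq_bigr => i _; rewrite -big_split.
have E2 : \sum_i dN j i i = \sum_i ddX i j i
    + (\sum_i \sum_k dC j i i k * X k + \sum_i \sum_k C i i k * dX j k).
  rewrite -!big_split; apply: eq_bigr => i _; rewrite -big_split.
  by rewrite /dN ddX_sym.
have E3 : \sum_i \sum_l C i i l * N j l = \sum_i \sum_k C i i k * dX j k
    + \sum_i \sum_k \sum_l C i i l * C l j k * X k.
  rewrite -big_split; apply: eq_bigr => i _.
  rewrite [X in _ = _ + X]exchange_big -big_split; apply: eq_bigr => l _.
  by rewrite mulrDr mulr_sumr; congr (_ + _); apply: eq_bigr => k _; rewrite mulrA.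
have E4 : \sum_i \sum_l C l i j * N l i = \sum_i \sum_k C i j k * dX i k
    + \sum_i \sum_k \sum_l C i j l * C l k i * X k.
  rewrite exchange_big -big_split; apply: eq_bigr => i _.
  rewrite [X in _ = _ + X]exchange_big -big_split; apply: eq_bigr => l _.
  rewrite mulrDr mulr_sumr C_sym; congr (_ + _).
  by apply: eq_bigr => k _; rewrite mulrA (C_sym l k i).
have E5 : \sum_k X k * Ric k j = \sum_i \sum_k dC i i j k * X k
   - \sum_i \sum_k dC j i i k * X k
   + (\sum_i \sum_k \sum_l C i i l * C l j k * X k
     - \sum_i \sum_k \sum_l C i j l * C l k i * X k).
  under eq_bigr do rewrite mulr_sumr.
  rewrite exchange_big -!sumrB -big_split; apply: eq_bigr => i _.
  rewrite -!sumrB -big_split; apply: eq_bigr => k _.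
  rewrite -!sumrB mulrDr mulr_sumr; congr (_ + _).
    by rewrite (dC_sym i i k j) (dC_sym j i k i); ring.
  by apply: eq_bigr => l _; rewrite (C_sym l k j); ring.
by rewrite E1 E2 E3 E4 E5; ring.
Qed.

Lemma bochner_algebra :
  \sum_i (\sum_j (dX i j * N j i + X j * dN i j i)
          + \sum_l C i i l * \sum_j X j * N j l)
  - \sum_j X j * \sum_i dN j i i =
  \sum_j \sum_k X j * X k * Ric j k + \sum_i \sum_j N i j * N j i.
Proof.
have E1 : \sum_i \sum_j (dX i j * N j i + X j * dN i j i) =
   \sum_i \sum_j N i j * N j i - \sum_j X j * \sum_i \sum_l C l i j * N l i
   + \sum_j X j * \sum_i dN i j i.
  have -> : \sum_j X j * \sum_i \sum_l C l i j * N l i =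
      \sum_i \sum_j (\sum_k C j i k * X k) * N j i.
    under eq_bigr do rewrite mulr_sumr.
    rewrite exchange_big; apply: eq_bigr => i _.
    under eq_bigr do rewrite mulr_sumr.
    rewrite exchange_big; apply: eq_bigr => l _.
    by rewrite mulr_suml; apply: eq_bigr => k _; ring.
  have -> : \sum_j X j * \sum_i dN i j i = \sum_i \sum_j X j * dN i j i.
    by under eq_bigr do rewrite mulr_sumr; rewrite exchange_big.
  rewrite -sumrB -big_split; apply: eq_bigr => i _.
  rewrite -sumrB -big_split; apply: eq_bigr => j _.
  by rewrite /N /=; ring.
have E2 : \sum_i \sum_l C i i l * (\sum_j X j * N j l) =
    \sum_j X j * \sum_i \sum_l C i i l * N j l.
  under [RHS]eq_bigr do rewrite mulr_sumr.
  rewrite [RHS]exchange_big; apply: eq_bigr => i _.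
  under [RHS]eq_bigr do rewrite mulr_sumr.
  rewrite [RHS]exchange_big; apply: eq_bigr => l _.
  by rewrite mulr_sumr; apply: eq_bigr => j _; ring.
have E3 : \sum_j \sum_k X j * X k * Ric j k = \sum_j X j * \sum_k X k * Ric k j.
  rewrite exchange_big; apply: eq_bigr => j _; rewrite mulr_sumr.
  by apply: eq_bigr => k _; ring.
rewrite big_split E1 E2 E3 /=.
under [X in _ = X + _]eq_bigr do rewrite -commutator mulrBr !mulrDr.
by rewrite sumrB !big_split /=; ring.
Qed.

End BochnerAlgebra.

(** * Covariant derivatives in a chart *)

Section Chart.
Context {R : realType} {n : nat}.
Implicit Types (U : set 'rV[R]_n) (f h : 'rV[R]_n -> R) (x : 'rV[R]_n).
Implicit Types (X Y : 'rV[R]_n -> 'rV[R]_n) (v w : 'rV[R]_n) (G : 'M[R]_n).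

Definition inner G v w : R := (v *m G *m w^T) 0 0.

(** The derivative of [f] along [v], that is df(v). *)
Definition dd v f x : R := (v *m (dform f x)^T) 0 0.

Definition CkV k U X := forall j, Ck k U (fun y => X y 0 j).

Definition hessian (g : 'rV[R]_n -> 'M[R]_n) f x : 'M[R]_n :=
  \matrix_(i, j) (pd i (pd j f) x - \sum_k christoffel g k i j x * pd k f x).

Definition ricci_mx (g : 'rV[R]_n -> 'M[R]_n) x : 'M[R]_n :=
  \matrix_(i, j) ricci g i j x.

Lemma trmx00 (a : 'M[R]_1) : a^T 0 0 = a 0 0. Proof. by rewrite mxE. Qed.

Lemma innerC G v w : G^T = G -> inner G v w = inner G w v.
Proof. by move=> sG; rewrite /inner -trmx00 !trmx_mul trmxK sG mulmxA. Qed.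

Lemma innerDl G v w z : inner G (v + w) z = inner G v z + inner G w z.
Proof. by rewrite /inner !mulmxDl mxE. Qed.

Lemma innerZl G a v z : inner G (a *: v) z = a * inner G v z.
Proof. by rewrite /inner -!scalemxAl mxE. Qed.

Lemma innerZr G a v z : inner G z (a *: v) = a * inner G z v.
Proof. by rewrite /inner linearZ -scalemxAr mxE. Qed.

Lemma inner_suml G (I : finType) (F : I -> 'rV[R]_n) v :
  inner G (\sum_i F i) v = \sum_i inner G (F i) v.
Proof. by rewrite /inner !mulmx_suml summxE. Qed.

Lemma inner_sumr G (I : finType) (F : I -> 'rV[R]_n) v :
  inner G v (\sum_i F i) = \sum_i inner G v (F i).
Proof. by rewrite /inner linear_sum mulmx_sumr summxE. Qed.

Lemma ddE v f x : dd v f x = \sum_i v 0 i * pd i f x.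
Proof. by rewrite /dd mxE; apply: eq_bigr => i _; rewrite !mxE. Qed.

Lemma ddZl a v f x : dd (a *: v) f x = a * dd v f x.
Proof. by rewrite /dd -scalemxAl mxE. Qed.

Lemma dd_suml (I : finType) (a : I -> 'rV[R]_n) f x :
  dd (\sum_i a i) f x = \sum_i dd (a i) f x.
Proof. by rewrite /dd mulmx_suml summxE. Qed.

Lemma eq_dform U f h x : open U -> (forall y, U y -> f y = h y) -> U x ->
  dform f x = dform h x.
Proof. by move=> oU fh Ux; apply/rowP => i; rewrite !mxE; exact: eq_pd fh Ux. Qed.

Lemma eq_dd U v f h x : open U -> (forall y, U y -> f y = h y) -> U x ->
  dd v f x = dd v h x.
Proof. by move=> oU fh Ux; rewrite /dd (eq_dform oU fh Ux). Qed.

Lemma dd_cst v c x : dd v (fun=> c) x = 0.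
Proof. by rewrite ddE big1 // => i _; rewrite pd_cst mulr0. Qed.

Lemma ddM v f h x : differentiable f x -> differentiable h x ->
  dd v (fun y => f y * h y) x = dd v f x * h x + f x * dd v h x.
Proof.
move=> df dh; rewrite !ddE mulr_suml mulr_sumr -big_split.
by apply: eq_bigr => i _; rewrite pdM //=; ring.
Qed.

Lemma eq_nabla U g X Y x : open U -> (forall y, U y -> X y = Y y) -> U x ->
  nabla g X x = nabla g Y x.
Proof.
move=> oU XY Ux; apply/matrixP => i k; rewrite !mxE XY //; congr (_ + _).
by apply: eq_pd Ux => // y Uy; rewrite XY.
Qed.

Lemma nablaZ g f X x : differentiable f x ->
  (forall j, differentiable (fun y => X y 0 j) x) ->
  nabla g (fun y => f y *: X y) x = (dform f x)^T *m X x + f x *: nabla g X x.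
Proof.
move=> df dX; apply/matrixP => i k; rewrite !mxE big_ord1 !mxE.
rewrite (_ : (fun y => _) = (fun y => f y * X y 0 k)); last first.
  by apply/funext => y; rewrite mxE.
rewrite pdM // mulrDr mulr_sumr addrA; congr (_ + _).
by apply: eq_bigr => j _; rewrite mxE; ring.
Qed.

Lemma nabla_sum g (I : finType) (F : I -> 'rV[R]_n -> 'rV[R]_n) x :
  (forall a j, differentiable (fun y => F a y 0 j) x) ->
  nabla g (fun y => \sum_a F a y) x = \sum_a nabla g (F a) x.
Proof.
move=> dF; apply/matrixP => i k; rewrite summxE !mxE.
rewrite (_ : (fun y => _) = (fun y => \sum_a F a y 0 k)); last first.
  by apply/funext => y; rewrite summxE.
rewrite pd_sum //.
under [RHS]eq_bigr do rewrite mxE.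
rewrite big_split /=; congr (_ + _).
rewrite exchange_big; apply: eq_bigr => j _.
by rewrite summxE mulr_sumr.
Qed.

Section Metric.
Variables (U : set 'rV[R]_n) (g : 'rV[R]_n -> 'M[R]_n).
Hypotheses (oU : open U) (gC : forall i j, Ck 2 U (fun y => g y i j))
  (gS : forall y, U y -> (g y)^T = g y) (gU : forall y, U y -> g y \in unitmx).

Let g_sym y i j : U y -> g y i j = g y j i.
Proof. by move=> Uy; rewrite -[in LHS](gS Uy) mxE. Qed.

Lemma christoffel_sym k i j x : U x -> christoffel g k i j x = christoffel g k j i x.
Proof.
move=> Ux; rewrite /christoffel; congr (_ * _); apply: eq_bigr => l _.
congr (_ * _); rewrite (@eq_pd _ _ U (fun y => g y i j) (fun y => g y j i)) //.
  by rewrite [pd i _ x + _]addrC.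
by move=> y; exact: g_sym.
Qed.

Lemma christoffel_C1 k i j : Ck 1 U (christoffel g k i j).
Proof.
apply: Ck_scale => //; apply: Ck_sum => // l _ /=.
apply: Ck_mul => //.
  by apply: Ck_invmx => // a b; apply: Ck_le (gC a b).
by apply: Ck_sub => //; first apply: Ck_add => //; exact: Ck_pd.
Qed.

(** The metric is parallel. Lowering the index of a Christoffel symbol inverts
    the matrix in its definition and leaves three derivatives of the metric;
    in the sum of two such terms only the derivative along [k] survives. *)
Lemma pd_metric k i j x : U x -> pd k (fun y => g y i j) x =
  \sum_l christoffel g l k i x * g x l j + \sum_l christoffel g l k j x * g x i l.
Proof.
move=> Ux.
have lower a b c : \sum_l christoffel g l a b x * g x l c =
   2^-1 * (pd a (fun y => g y b c) x + pd b (fun y => g y a c) x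
           - pd c (fun y => g y a b) x).
  pose T := \col_m (pd a (fun y => g y b m) x + pd b (fun y => g y a m) x
           - pd m (fun y => g y a b) x).
  transitivity (2^-1 * (g x *m (invmx (g x) *m T)) c 0); last first.
    by rewrite mulKVmx ?gU // !mxE.
  rewrite [in RHS]mxE mulr_sumr; apply: eq_bigr => l _.
  rewrite mxE (g_sym l c) // /christoffel -mulrA; congr (_ * _).
  rewrite mulrC; congr (_ * _).
  by apply: eq_bigr => m _; rewrite !mxE.
have -> : \sum_l christoffel g l k j x * g x i l =
          \sum_l christoffel g l k j x * g x l i.
  by apply: eq_bigr => l _; rewrite g_sym.
rewrite !lower.
rewrite (@eq_pd _ _ U (fun y => g y j i) (fun y => g y i j)) //; last first.
  by move=> y; exact: g_sym.
by field.
Qed.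

Lemma hessian_sym f x : U x -> Ck 2 U f -> (hessian g f x)^T = hessian g f x.
Proof.
move=> Ux fC; apply/matrixP => i j; rewrite !mxE (pd_comm j i oU fC Ux).
by congr (_ - _); apply: eq_bigr => k _; rewrite christoffel_sym.
Qed.

Lemma laplacian_tr f x : U x -> Ck 2 U f ->
  laplacian g f x = \tr (invmx (g x) *m hessian g f x).
Proof.
move=> Ux fC; rewrite /mxtrace; apply: eq_bigr => i _; rewrite mxE.
apply: eq_bigr => j _; congr (_ * _).
by rewrite -[hessian g f x](hessian_sym Ux fC) !mxE.
Qed.

(** The product rule has no term in the derivative of the metric, by
    [pd_metric]. *)
Lemma dd_inner v X Y x : U x ->
  (forall j, differentiable (fun y => X y 0 j) x) ->
  (forall j, differentiable (fun y => Y y 0 j) x) ->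
  dd v (fun y => inner (g y) (X y) (Y y)) x =
    inner (g x) (v *m nabla g X x) (Y x) + inner (g x) (X x) (v *m nabla g Y x).
Proof.
move=> Ux dX dY.
have dg i j : differentiable (fun y => g y i j) x.
  exact: Ck1_differentiable (gC i j) Ux.
have innerE G a b : inner G a b = \sum_i \sum_j a 0 i * G i j * b 0 j.
  rewrite /inner mxE exchange_big; apply: eq_bigr => j _.
  by rewrite !mxE mulr_suml.
have -> : (fun y => inner (g y) (X y) (Y y)) =
          (fun y => \sum_i \sum_j X y 0 i * g y i j * Y y 0 j).
  by apply/funext => y; rewrite innerE.
have dXg i j : differentiable (fun y => X y 0 i * g y i j) x.
  by apply: differentiableM.
have dXgY i j : differentiable (fun y => X y 0 i * g y i j * Y y 0 j) x.
  by apply: (@differentiableM _ _ (fun y => X y 0 i * g y i j)).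
rewrite ddE.
transitivity (\sum_k v 0 k *
   (inner (g x) (row k (nabla g X x)) (Y x) +
    inner (g x) (X x) (row k (nabla g Y x)))); last first.
  rewrite (mulmx_sum_row v (nabla g X x)) (mulmx_sum_row v (nabla g Y x)).
  rewrite inner_suml inner_sumr -big_split; apply: eq_bigr => k _.
  by rewrite innerZl innerZr mulrDr.
apply: eq_bigr => k _; congr (_ * _).
rewrite pd_sum; last by move=> i; exact: differentiable_bigsum.
under eq_bigr do rewrite pd_sum //.
rewrite !innerE.
have S1 : \sum_i \sum_j X x 0 i * (\sum_l christoffel g l k i x * g x l j) * Y x 0 j =
   \sum_i \sum_j (\sum_l christoffel g i k l x * X x 0 l) * g x i j * Y x 0 j.
  rewrite exchange_big [RHS]exchange_big; apply: eq_bigr => j _.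
  under eq_bigr do rewrite mulr_sumr mulr_suml.
  under [RHS]eq_bigr do rewrite mulr_suml mulr_suml.
  rewrite exchange_big; apply: eq_bigr => l _; apply: eq_bigr => i _; ring.
have S2 : \sum_i \sum_j X x 0 i * (\sum_l christoffel g l k j x * g x i l) * Y x 0 j =
   \sum_i \sum_j X x 0 i * g x i j * (\sum_l christoffel g j k l x * Y x 0 l).
  apply: eq_bigr => i _.
  under eq_bigr do rewrite mulr_sumr mulr_suml.
  under [RHS]eq_bigr do rewrite mulr_sumr.
  rewrite exchange_big; apply: eq_bigr => l _; apply: eq_bigr => j _; ring.
have -> : \sum_i \sum_j row k (nabla g X x) 0 i * g x i j * Y x 0 j =
    \sum_i \sum_j pd k (fun y => X y 0 i) x * g x i j * Y x 0 j
    + \sum_i \sum_j X x 0 i * (\sum_l christoffel g l k i x * g x l j) * Y x 0 j.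
  rewrite S1 -big_split; apply: eq_bigr => i _; rewrite -big_split.
  by apply: eq_bigr => j _; rewrite !mxE /=; ring.
have -> : \sum_i \sum_j X x 0 i * g x i j * row k (nabla g Y x) 0 j =
    \sum_i \sum_j X x 0 i * g x i j * pd k (fun y => Y y 0 j) x
    + \sum_i \sum_j X x 0 i * (\sum_l christoffel g l k j x * g x i l) * Y x 0 j.
  rewrite S2 -big_split; apply: eq_bigr => i _; rewrite -big_split.
  by apply: eq_bigr => j _; rewrite !mxE /=; ring.
rewrite -!big_split; apply: eq_bigr => i _; rewrite -!big_split.
apply: eq_bigr => j _; rewrite (pdM k (dXg i j) (dY j)) pdM // pd_metric //=.
ring.
Qed.

(** Second derivatives of a function along fields: with the symmetry of the
    Hessian this is the vanishing of the torsion, and summed over an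
    orthonormal frame it computes the Laplacian. *)
Lemma dd_dd v f X x : U x -> Ck 2 U f ->
  (forall j, differentiable (fun y => X y 0 j) x) ->
  dd v (fun y => dd (X y) f y) x =
    (v *m hessian g f x *m (X x)^T) 0 0 + dd (v *m nabla g X x) f x.
Proof.
move=> Ux fC dX.
have dpf i : differentiable (pd i f) x.
  by apply: Ck1_differentiable (Ck_pd i fC) Ux.
have -> : (fun y => dd (X y) f y) = (fun y => \sum_i X y 0 i * pd i f y).
  by apply/funext => y; rewrite ddE.
rewrite ddE.
transitivity (\sum_k v 0 k * ((row k (hessian g f x) *m (X x)^T) 0 0
   + dd (row k (nabla g X x)) f x)); last first.
  rewrite (mulmx_sum_row v (nabla g X x)) (mulmx_sum_row v (hessian g f x)).
  rewrite dd_suml mulmx_suml summxE -big_split.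
  apply: eq_bigr => k _; rewrite ddZl -scalemxAl mulrDr /=; congr (_ + _).
  by rewrite [RHS]mxE.
apply: eq_bigr => k _; congr (_ * _).
rewrite pd_sum; last by move=> i; exact: differentiableM.
rewrite ddE mxE.
have S : \sum_j (\sum_l christoffel g l k j x * pd l f x) * X x 0 j =
   \sum_i (\sum_j christoffel g i k j x * X x 0 j) * pd i f x.
  under eq_bigr do rewrite mulr_suml.
  rewrite exchange_big; apply: eq_bigr => l _; rewrite mulr_suml.
  by apply: eq_bigr => j _; ring.
transitivity (\sum_j pd k (pd j f) x * X x 0 j
  - \sum_j (\sum_l christoffel g l k j x * pd l f x) * X x 0 j
  + (\sum_i pd k (fun y => X y 0 i) x * pd i f x
    + \sum_i (\sum_j christoffel g i k j x * X x 0 j) * pd i f x)).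
  rewrite S [RHS](_ : _ = \sum_j pd k (pd j f) x * X x 0 j
    + \sum_i pd k (fun y => X y 0 i) x * pd i f x); last by ring.
  by rewrite -big_split; apply: eq_bigr => i _; rewrite pdM //=; ring.
rewrite -sumrB -big_split; congr (_ + _); apply: eq_bigr => i _.
  by rewrite !mxE mulrBl.
by rewrite !mxE mulrDl.
Qed.

Lemma nabla_C1 X : CkV 2 U X ->
  forall j i, Ck 1 U (fun y => nabla g X y j i).
Proof.
move=> XC j i.
apply: (@eq_Ck _ _ _ _ (fun y => pd j (fun z => X z 0 i) y
                  + \sum_k christoffel g i j k y * X y 0 k)) => //.
  by move=> y _; rewrite mxE.
apply: Ck_add => //; first exact/Ck_pd/XC.
apply: Ck_sum => // k _; apply: Ck_mul => //; first exact: christoffel_C1.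
exact: Ck_le (XC k).
Qed.

(** The Bochner identity: interchanging the two covariant derivatives in the
    divergence of nabla_X X produces the Ricci term. *)
Lemma bochner X x : U x -> CkV 2 U X ->
  \tr (nabla g (fun y => X y *m nabla g X y) x)
    - dd (X x) (fun y => \tr (nabla g X y)) x =
  (X x *m ricci_mx g x *m (X x)^T) 0 0 + \tr (nabla g X x *m nabla g X x).
Proof.
move=> Ux XC.
have dX j : differentiable (fun y => X y 0 j) x.
  exact: Ck1_differentiable (XC j) Ux.
have dpX i j : differentiable (pd i (fun y => X y 0 j)) x.
  exact: Ck1_differentiable (Ck_pd i (XC j)) Ux.
have dG k i j : differentiable (christoffel g k i j) x.
  exact: Ck1_differentiable (christoffel_C1 k i j) Ux.
have dN i k : differentiable (fun y => nabla g X y i k) x.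
  exact: Ck1_differentiable (nabla_C1 XC i k) Ux.
have pdN a j i : pd a (fun y => nabla g X y j i) x =
    pd a (pd j (fun z => X z 0 i)) x
    + \sum_k (pd a (christoffel g i j k) x * X x 0 k
              + christoffel g i j k x * pd a (fun z => X z 0 k) x).
  rewrite (@eq_pd _ _ U _ (fun y => pd j (fun z => X z 0 i) y
                  + \sum_k christoffel g i j k y * X y 0 k)) //; last first.
    by move=> y _; rewrite mxE.
  rewrite pdD //; last by apply: differentiable_bigsum => k; exact: differentiableM.
  rewrite pd_sum; last by move=> k; exact: differentiableM.
  by congr (_ + _); apply: eq_bigr => k _; rewrite pdM.
have := @bochner_algebra R n (fun j => X x 0 j)
  (fun i k => pd i (fun z => X z 0 k) x)
  (fun a j i => pd a (pd j (fun z => X z 0 i)) x)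
  (fun k i j => christoffel g k i j x)
  (fun a k i j => pd a (christoffel g k i j) x)
  (fun a b k => pd_comm a b oU (XC k) Ux)
  (fun k i j => christoffel_sym k i j Ux)
  (fun l k a b => eq_pd l oU (fun y => @christoffel_sym k a b y) Ux).
have -> : \tr (nabla g (fun y => X y *m nabla g X y) x) =
  \sum_i (\sum_j (pd i (fun z => X z 0 j) x * nabla g X x j i
                  + X x 0 j * pd i (fun y => nabla g X y j i) x)
     + \sum_l christoffel g i i l x * \sum_j X x 0 j * nabla g X x j l).
  apply: eq_bigr => i _; rewrite mxE; congr (_ + _); last first.
    by apply: eq_bigr => l _; rewrite mxE.
  rewrite (_ : (fun y => _) = (fun y => \sum_j X y 0 j * nabla g X y j i)).
    rewrite pd_sum; last by move=> j; exact: differentiableM.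
    by apply: eq_bigr => j _; rewrite pdM.
  by apply/funext => y; rewrite mxE.
have -> : dd (X x) (fun y => \tr (nabla g X y)) x =
   \sum_j X x 0 j * \sum_i pd j (fun y => nabla g X y i i) x.
  by rewrite ddE; apply: eq_bigr => j _; rewrite pd_sum.
have -> : (X x *m ricci_mx g x *m (X x)^T) 0 0 =
   \sum_j \sum_k X x 0 j * X x 0 k * ricci g j k x.
  rewrite mxE exchange_big; apply: eq_bigr => k _; rewrite !mxE mulr_suml.
  by apply: eq_bigr => j _; rewrite !mxE; ring.
have -> : \tr (nabla g X x *m nabla g X x) =
   \sum_i \sum_j nabla g X x i j * nabla g X x j i.
  by apply: eq_bigr => i _; rewrite mxE.
have NE i j : nabla g X x i j = pd i (fun y => X y 0 j) x
   + \sum_k christoffel g j i k x * X x 0 k by rewrite mxE.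
move=> E.
under eq_bigr => i _.
  under eq_bigr => j _ do rewrite pdN NE.
  under [X in _ + X]eq_bigr => l _.
    under eq_bigr => j _ do rewrite NE.
    over.
  over.
under [X in _ - X]eq_bigr => j _.
  under eq_bigr => i _ do rewrite pdN.
  over.
under [X in _ = _ + X]eq_bigr => i _.
  under eq_bigr => j _ do rewrite !NE.
  over.
exact: E.
Qed.

End Metric.
End Chart.

(** * Connection coefficients of a flag-adapted frame *)

Section FlagFrame.
Context {R : realFieldType} {n : nat}.
Variable om : 'I_n -> 'I_n -> 'I_n -> R.
Hypotheses (om_skew : forall i j k, om i j k = - om i k j)
  (om_flag : forall i j m : 'I_n,
     (m < i)%N -> (m < j)%N -> om i j m = om j i m).

Let F i j k := om i j k * om j i k.

Let om_diag i j : om i j j = 0.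
Proof. by have := om_skew i j j; lra. Qed.

(* Skew in (j, k) against symmetric in (j, k). *)
Let smallest_first (i : 'I_n) :
  \sum_(j < n) \sum_(k < n) (if (i < j)%N && (i < k)%N then F i j k else 0) = 0.
Proof.
set S := LHS; suff : S = - S by lra.
rewrite {1}/S exchange_big -sumrN; apply: eq_bigr => j _.
rewrite -sumrN; apply: eq_bigr => k _; rewrite andbC.
case: ifP => [/andP[ij ik]|_]; last by rewrite oppr0.
by rewrite /F (om_skew i k j) (om_skew k i j) (om_skew j i k) (om_flag ik ij); ring.
Qed.

(** The terms are sorted by their smallest index. If it is the last one, k,
    the flag symmetry makes the term a square. If it is i or j alone, the
    terms cancel in pairs ([smallest_first]); if i = j < k, the term is a
    square again. *)
Lemma flag_sum_of_squares :
  \sum_i \sum_j \sum_k om i j k * om j i k =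
  \sum_(k < n) \sum_(i < n) \sum_(j < n)
     (if (k < i)%N && (k < j)%N then om i j k ^+ 2 else 0)
  + \sum_(i < n) \sum_(k < n) (if (i < k)%N then om i i k ^+ 2 else 0).
Proof.
have E (i j k : 'I_n) : F i j k =
    (if (k < i)%N && (k < j)%N then om i j k ^+ 2 else 0)
    + (if i == j then if (i < k)%N then om i i k ^+ 2 else 0 else 0)
    + (if (i < j)%N && (i < k)%N then F i j k else 0)
    + (if (j < i)%N && (j < k)%N then F j i k else 0).
  rewrite /F [om j i k * _]mulrC.
  have [eij|nij] := eqVneq i j.
    subst j; rewrite ltnn /= andbb; case: ltngtP => [ik|ki|/val_inj eik] //.
    - by rewrite expr2; ring.
    - by rewrite expr2; ring.
    - by subst k; rewrite om_diag; ring.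
  have [eik|nik] := eqVneq i k.
    by subst k; rewrite !ltnn om_diag ?andbF /=; case: ifP => _; ring.
  have [ejk|njk] := eqVneq j k.
    by subst k; rewrite !ltnn om_diag !andbF /=; case: ifP => _; ring.
  have := om_flag (i := i) (j := j) (m := k).
  have nij' : (i : nat) != j by [].
  have nik' : (i : nat) != k by [].
  have njk' : (j : nat) != k by [].
  case: (ltngtP i j) nij' => // ij _; case: (ltngtP i k) nik' => // ik _;
  case: (ltngtP j k) njk' => // jk _ /= fl;
  solve [ring | rewrite (fl isT isT); ring
     | have := ltn_trans (ltn_trans ij jk) ik; by rewrite ltnn
     | have := ltn_trans (ltn_trans ij ik) jk; by rewrite ltnn].
have S1 : \sum_(i < n) \sum_(j < n) \sum_(k < n)
     (if (k < i)%N && (k < j)%N then om i j k ^+ 2 else 0) =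
   \sum_(k < n) \sum_(i < n) \sum_(j < n)
     (if (k < i)%N && (k < j)%N then om i j k ^+ 2 else 0).
  rewrite [RHS]exchange_big; apply: eq_bigr => i _.
  by rewrite [RHS]exchange_big.
have S2 : \sum_(i < n) \sum_(j < n) \sum_(k < n)
     (if i == j then if (i < k)%N then om i i k ^+ 2 else 0 else 0) =
   \sum_(i < n) \sum_(k < n) (if (i < k)%N then om i i k ^+ 2 else 0).
  apply: eq_bigr => i _; rewrite exchange_big; apply: eq_bigr => k _.
  by rewrite -big_mkcond (big_pred1 i) // => j; rewrite eq_sym.
have S3 : \sum_(i < n) \sum_(j < n) \sum_(k < n)
     (if (i < j)%N && (i < k)%N then F i j k else 0) = 0.
  by rewrite big1 // => i _; exact: smallest_first.
have S4 : \sum_(i < n) \sum_(j < n) \sum_(k < n)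
     (if (j < i)%N && (j < k)%N then F j i k else 0) = 0.
  by rewrite exchange_big big1 // => i _; exact: smallest_first.
rewrite -S1 -S2 -[RHS]addr0 -[X in _ + X]S3 -[RHS]addr0 -[X in _ + X]S4.
rewrite -!big_split.
apply: eq_bigr => i _; rewrite -!big_split; apply: eq_bigr => j _.
by rewrite -!big_split; apply: eq_bigr => k _; exact: E.
Qed.

(** The squares with smallest index [o] are, by skewness, all the
    [om i o k ^+ 2]. *)
Lemma flag_sum_ge (o : 'I_n) : o = 0%N :> nat ->
  \sum_i \sum_k om i o k ^+ 2 <= \sum_i \sum_j \sum_k om i j k * om j i k.
Proof.
move=> o0; rewrite flag_sum_of_squares.
have ogt (i : 'I_n) : i != o -> (o < i)%N.
  move=> io; rewrite o0 lt0n; apply: contraNneq io => i0.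
  by apply/eqP/val_inj; rewrite /= i0.
have -> : \sum_i \sum_k om i o k ^+ 2 =
  \sum_(i < n) \sum_(j < n) (if (o < i)%N && (o < j)%N then om i j o ^+ 2 else 0)
  + \sum_(k < n) (if (o < k)%N then om o o k ^+ 2 else 0).
  rewrite [RHS](_ : _ = \sum_(i < n) (\sum_(j < n)
      (if (o < i)%N && (o < j)%N then om i j o ^+ 2 else 0)
     + if i == o then \sum_(k < n) (if (o < k)%N then om o o k ^+ 2 else 0) else 0)).
    apply: eq_bigr => i _; have [->|io] := eqVneq i o.
      rewrite [X in _ = X + _]big1 => [|j _]; last by rewrite ltnn.
      rewrite add0r; apply: eq_bigr => k _.
      have [-> |ko] := eqVneq k o; first by rewrite ltnn om_diag expr0n.
      by rewrite ogt.
    rewrite addr0; apply: eq_bigr => k _.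
    have [-> |ko] := eqVneq k o; first by rewrite ltnn andbF om_diag expr0n.
    by rewrite !ogt //= om_skew sqrrN.
  by rewrite big_split /=; congr (_ + _); rewrite -[RHS]big_mkcond big_pred1_eq.
apply: lerD.
  rewrite [leRHS](bigD1 o) //= lerDl; apply: sumr_ge0 => k _.
  apply: sumr_ge0 => i _; apply: sumr_ge0 => j _.
  by case: ifP => _; rewrite ?sqr_ge0.
rewrite [leRHS](bigD1 o) //= lerDl; apply: sumr_ge0 => i _.
by apply: sumr_ge0 => k _; case: ifP => _; rewrite ?sqr_ge0.
Qed.

End FlagFrame.

(** * Orthonormal frames *)

Section Orthonormal.
Context {R : realType} {n : nat}.
Variables (G : 'M[R]_n) (e : 'I_n -> 'rV[R]_n).
Hypothesis e_on : forall i j, inner G (e i) (e j) = (i == j)%:R.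

Lemma orthonormal_complete : \sum_k G *m (e k)^T *m e k = 1%:M.
Proof.
pose E : 'M[R]_n := \matrix_(k < n) e k.
have EGE : E *m (G *m E^T) = 1%:M.
  apply/matrixP => i j; rewrite mulmxA [RHS]mxE -e_on.
  rewrite /inner !mxE; apply: eq_bigr => k _; rewrite !mxE; congr (_ * _).
  by apply: eq_bigr => l _; rewrite !mxE.
rewrite -(mulmx1C EGE); apply/matrixP => i j; rewrite summxE [RHS]mxE.
apply: eq_bigr => k _; rewrite !mxE big_ord1 !mxE; congr (_ * _).
by apply: eq_bigr => l _; rewrite !mxE.
Qed.

Lemma orthonormal_expand v : v = \sum_k inner G v (e k) *: e k.
Proof.
rewrite -[LHS]mulmx1 -orthonormal_complete mulmx_sumr; apply: eq_bigr => k _.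
by rewrite !mulmxA [v *m G *m _]mx11_scalar mul_scalar_mx.
Qed.

Lemma orthonormal_parseval v w :
  inner G v w = \sum_k inner G v (e k) * inner G (e k) w.
Proof.
rewrite {1}[v]orthonormal_expand inner_suml.
by apply: eq_bigr => k _; rewrite innerZl.
Qed.

Lemma orthonormal_trace (N : 'M[R]_n) : \tr N = \sum_k inner G (e k *m N) (e k).
Proof.
rewrite -[in LHS](mul1mx N) -orthonormal_complete mulmx_suml linear_sum.
apply: eq_bigr => k _ /=.
by rewrite -[_ *m e k *m N]mulmxA mxtrace_mulC mulmxA trace_mx11.
Qed.

Lemma orthonormal_invmx : G \in unitmx -> invmx G = \sum_k (e k)^T *m e k.
Proof.
move=> Gu; rewrite -[LHS]mulmx1 -orthonormal_complete mulmx_sumr.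
by apply: eq_bigr => k _; rewrite -(mulmxA G) mulKmx.
Qed.

Lemma orthonormal_trace_invmx (N : 'M[R]_n) : G \in unitmx ->
  \tr (invmx G *m N) = \sum_k (e k *m N *m (e k)^T) 0 0.
Proof.
move=> Gu; rewrite orthonormal_invmx // mulmx_suml linear_sum.
apply: eq_bigr => k _ /=.
by rewrite -(mulmxA _ _ N) mxtrace_mulC trace_mx11.
Qed.

End Orthonormal.

(** * Gram-Schmidt orthonormalization of gradients *)

Section GramSchmidt.
Context {R : realType} {n : nat}.
Implicit Types (G : 'M[R]_n) (d : nat -> 'rV[R]_n) (m : nat).

Definition stack d m : 'M[R]_(m, n) := \matrix_(j < m) d j.

(** The orthogonal projection along the gradients of the first [m] covectors,
    acting on row vectors; [invmx G] turns a covector into its gradient. *)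
Fixpoint gs_proj G d m : 'M[R]_n :=
  if m is m'.+1 then
    let v := d m' *m invmx G *m gs_proj G d m' in
    let e := (vnorm G v)^-1 *: v in
    gs_proj G d m' - G *m e^T *m e
  else 1%:M.

Definition gs_vec G d m : 'rV[R]_n := d m *m invmx G *m gs_proj G d m.

Definition gs_frame G d m : 'rV[R]_n := (vnorm G (gs_vec G d m))^-1 *: gs_vec G d m.

Lemma gs_projS G d m :
  gs_proj G d m.+1 = gs_proj G d m - G *m (gs_frame G d m)^T *m gs_frame G d m.
Proof. by []. Qed.

Variables (G : 'M[R]_n) (d : nat -> 'rV[R]_n).
Hypotheses (G_sym : G^T = G)
  (G_pos : forall v : 'rV[R]_n, v != 0 -> 0 < (v *m G *m v^T) 0 0).

Local Notation D := (stack d).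

Hypothesis D_free : row_free (D n).

Lemma posdef_unitmx : G \in unitmx.
Proof.
rewrite -row_free_unit -kermx_eq0; apply/eqP/row_matrixP => i.
rewrite row0; apply/eqP; apply: contraT => /G_pos.
by rewrite -row_mul mulmx_ker row0 mul0mx mxE ltxx.
Qed.

Lemma vnorm_gt0 v : v != 0 -> 0 < vnorm G v.
Proof. by move=> v0; rewrite sqrtr_gt0 G_pos. Qed.

Lemma inner_vnorm v : inner G v v = vnorm G v ^+ 2.
Proof.
rewrite sqr_sqrtr //; have [->|/G_pos/ltW //] := eqVneq v 0.
by rewrite !mul0mx mxE.
Qed.

Lemma vnormZ a v : vnorm G (a *: v) = `|a| * vnorm G v.
Proof.
rewrite /vnorm linearZ /= -!scalemxAl -scalemxAr scalerA mxE.
by rewrite sqrtrM ?sqr_ge0 // -expr2 sqrtr_sqr.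
Qed.

(* A right inverse of the matrix of the covectors separates d m from the
   earlier ones. *)
Let d_notin m : (m < n)%N -> ~~ (d m <= D m)%MS.
Proof.
move=> mn; have /row_freeP[V DV] := D_free.
have dV (j : 'I_n) k : (d j *m V) 0 k = (j == k)%:R.
  have := congr1 (fun A : 'M[R]_n => A j k) DV.
  by rewrite !mxE => <-; apply: eq_bigr => l _; rewrite !mxE.
apply/negP => /submxP[c dE].
have := dV (Ordinal mn) (Ordinal mn); rewrite eqxx /= dE -mulmxA mxE big1.
  by move/esym/eqP; rewrite oner_eq0.
move=> j _; have jn := ltn_trans (ltn_ord j) mn.
have -> : (D m *m V) j (Ordinal mn) = (d j *m V) 0 (Ordinal mn).
  by rewrite !mxE; apply: eq_bigr => l _; rewrite !mxE.
rewrite (dV (Ordinal jn)) -val_eqE /= ltn_eqF ?mulr0 //; exact: ltn_ord.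
Qed.

Let P := gs_proj G d.
Let e := gs_frame G d.

Let D_sub m : (D m <= D m.+1)%MS.
Proof.
apply/row_subP => j; rewrite rowK.
have -> : d j = row (widen_ord (leqnSn m) j) (D m.+1) by rewrite rowK.
exact: row_sub.
Qed.

(** The invariants say that [P m] is self-adjoint and idempotent, with image
    annihilated by the first [m] covectors and kernel spanned by their
    gradients. They are proved together because the next vector is nonzero by
    the last one, and the others pass to [m.+1] only once it can be
    normalized. *)
Lemma gs_invariants m : (m <= n)%N ->
  [/\ P m *m G = G *m (P m)^T, P m *m P m = P m,
      forall j, (j < m)%N -> P m *m (d j)^T = 0
    & (1%:M - P m <= D m *m invmx G)%MS] /\
  ((m < n)%N -> gs_vec G d m != 0).
Proof.
have Gu := posdef_unitmx.
have nz k : (1%:M - P k <= D k *m invmx G)%MS -> (k < n)%N -> gs_vec G d k != 0.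
  move=> sub kn; apply: contra (d_notin kn) => /eqP v0.
  have -> : d k = d k *m invmx G *m (1%:M - P k) *m G.
    by rewrite mulmxBr mulmx1 -/(gs_vec G d k) v0 subr0 mulmxKV.
  have -> : D k = D k *m invmx G *m G by rewrite mulmxKV.
  by apply: submxMr; apply: submx_trans sub; exact: submxMl.
elim: m => [_|m IH mn].
  have sub0 : (1%:M - P 0 <= D 0 *m invmx G)%MS by rewrite subrr sub0mx.
  by split; [split=> //=; rewrite ?trmx1 ?mul1mx ?mulmx1|exact: nz].
have [[PG PP Pd sub] v0] := IH (ltnW mn); have {}v0 := v0 mn.
have s0 := vnorm_gt0 v0.
have eP : e m *m P m = e m by rewrite -scalemxAl -mulmxA PP.
have PGe : P m *m (G *m (e m)^T) = G *m (e m)^T.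
  by rewrite mulmxA PG -mulmxA -trmx_mul eP.
have ee : e m *m G *m (e m)^T = 1%:M.
  rewrite [LHS]mx11_scalar -[(_ *m _) 0 0]/(inner G (e m) (e m)) inner_vnorm.
  by rewrite vnormZ gtr0_norm ?invr_gt0 // mulVf ?gt_eqF // expr1n.
have ed : P m *m (d m)^T = vnorm G (gs_vec G d m) *: (G *m (e m)^T).
  rewrite linearZ /= -scalemxAr scalerA mulfV ?gt_eqF // scale1r.
  rewrite /gs_vec !trmx_mul trmx_inv G_sym mulmxA -PG -mulmxA.
  by rewrite mulKVmx.
have PG1 : P m.+1 *m G = G *m (P m.+1)^T.
  rewrite /P gs_projS mulmxBl linearB /= mulmxBr PG; congr (_ - _).
  by rewrite !trmx_mul trmxK G_sym !mulmxA.
have PP1 : P m.+1 *m P m.+1 = P m.+1.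
  rewrite /P gs_projS -/(P m) -/(e m) mulmxBl !mulmxBr PP.
  rewrite (mulmxA (P m)) PGe -(mulmxA _ (e m) (P m)) eP.
  rewrite -[X in _ - (_ - X)]mulmxA [X in _ - (_ - _ *m X)]mulmxA.
  by rewrite [e m *m (G *m _)]mulmxA ee mul1mx subrr subr0.
have Pd1 j : (j < m.+1)%N -> P m.+1 *m (d j)^T = 0.
  rewrite ltnS leq_eqVlt /P gs_projS -/(P m) -/(e m) mulmxBl => /orP[/eqP ->|jm].
    have ed' : e m *m (d m)^T = (vnorm G (gs_vec G d m))%:M.
      by rewrite -[in LHS]eP -mulmxA ed -scalemxAr mulmxA ee scalemx1.
    by rewrite -[X in _ - X]mulmxA ed' mul_mx_scalar ed subrr.
  rewrite (Pd j jm) -[X in _ - X]mulmxA -eP -(mulmxA (e m)) (Pd j jm).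
  by rewrite !mulmx0 subr0.
have sub1 : (1%:M - P m.+1 <= D m.+1 *m invmx G)%MS.
  rewrite /P gs_projS -/(P m) -/(e m) opprB addrCA addrC.
  have subD : (D m *m invmx G <= D m.+1 *m invmx G)%MS.
    exact: submxMr (D_sub m).
  apply: addmx_sub; first exact: submx_trans sub subD.
  rewrite (submx_trans (submxMl _ _)) // scalemx_sub //.
  rewrite /gs_vec -/(P m).
  have -> : P m = 1%:M - (1%:M - P m) by rewrite opprB addrC subrK.
  rewrite mulmxBr mulmx1 addmx_sub //.
    rewrite submxMr //; have -> : d m = row ord_max (D m.+1) by rewrite rowK.
    exact: row_sub.
  rewrite eqmx_opp (submx_trans (submxMl _ _)) //; exact: submx_trans sub subD.
by split => //; exact: nz.
Qed.

Lemma gs_vec_gt0 m : (m < n)%N -> 0 < vnorm G (gs_vec G d m).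
Proof. by move=> mn; apply: vnorm_gt0; have [_ ->] := gs_invariants (ltnW mn). Qed.

Lemma gs_vecE m : (m < n)%N -> gs_vec G d m = vnorm G (gs_vec G d m) *: e m.
Proof.
by move=> mn; rewrite scalerA mulfV ?scale1r // gt_eqF // gs_vec_gt0.
Qed.

Lemma gs_frame_proj m : (m < n)%N -> e m *m P m = e m.
Proof.
move=> mn; have [[_ PP _ _] _] := gs_invariants (ltnW mn).
by rewrite -scalemxAl -mulmxA PP.
Qed.

Let gs_frame_norm m : (m < n)%N -> inner G (e m) (e m) = 1.
Proof.
move=> mn; have s0 := gs_vec_gt0 mn.
by rewrite inner_vnorm vnormZ gtr0_norm ?invr_gt0 // mulVf ?gt_eqF // expr1n.
Qed.

Let gs_frame_orth i j : (i < j)%N -> (j < n)%N ->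
  e i *m P j = 0 -> inner G (e i) (e j) = 0.
Proof.
move=> ij jn eP; have [[PG _ _ _] _] := gs_invariants (ltnW jn).
rewrite /inner -(gs_frame_proj jn) trmx_mul mulmxA -(mulmxA _ G) -PG.
by rewrite (mulmxA (e i)) eP !mul0mx mxE.
Qed.

Lemma gs_frame_proj0 i j : (i < j)%N -> (j <= n)%N -> e i *m P j = 0.
Proof.
elim: j => // j IH; rewrite ltnS leq_eqVlt => /orP[/eqP ->|ij] jn.
  rewrite /P gs_projS -/(P j) -/(e j) mulmxBr gs_frame_proj // !mulmxA.
  rewrite [e j *m G *m _]mx11_scalar -[(_ *m _) 0 0]/(inner G (e j) (e j)).
  by rewrite gs_frame_norm // mul1mx subrr.
rewrite /P gs_projS -/(P j) -/(e j) mulmxBr (IH ij (ltnW jn)) !mulmxA.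
rewrite [e i *m G *m _]mx11_scalar -[(_ *m _) 0 0]/(inner G (e i) (e j)).
rewrite (gs_frame_orth ij jn (IH ij (ltnW jn))).
by rewrite mul_scalar_mx scale0r subrr.
Qed.

Lemma gs_frame_orthonormal (i j : 'I_n) : inner G (e i) (e j) = (i == j)%:R.
Proof.
case: (ltngtP i j) => [ij|ji|/val_inj ->]; last by rewrite eqxx gs_frame_norm.
- rewrite (gs_frame_orth ij) //; last by rewrite gs_frame_proj0 // ltnW.
  by rewrite -val_eqE /= ltn_eqF.
- rewrite innerC // (gs_frame_orth ji) //; last by rewrite gs_frame_proj0 // ltnW.
  by rewrite -val_eqE /= gtn_eqF.
Qed.

Lemma gs_frame_dual0 m k : (m < k)%N -> (k < n)%N -> e k *m (d m)^T = 0.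
Proof.
move=> mk kn; have [[_ _ Pd _] _] := gs_invariants (ltnW kn).
by rewrite -(gs_frame_proj kn) -mulmxA Pd // mulmx0.
Qed.

Lemma gs_frame_dual m : (m < n)%N ->
  (e m *m (d m)^T) 0 0 = vnorm G (gs_vec G d m).
Proof.
move=> mn; have [[PG _ _ _] _] := gs_invariants (ltnW mn).
have Gu := posdef_unitmx; have s0 := gs_vec_gt0 mn.
have -> : (d m)^T = G *m (d m *m invmx G)^T.
  by rewrite trmx_mul trmx_inv G_sym mulKVmx.
rewrite -(gs_frame_proj mn) -mulmxA (mulmxA _ G) PG -(mulmxA G) -trmx_mul.
rewrite mulmxA -[RHS]mulr1 -(gs_frame_norm mn) -innerZr /inner.
by rewrite -gs_vecE.
Qed.

Lemma gs_proj_frame m : (m <= n)%N ->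
  P m = 1%:M - \sum_(k < n | (k < m)%N) G *m (e k)^T *m e k.
Proof.
elim: m => [_|m IH mn]; first by rewrite big_pred0 // subr0.
rewrite /P gs_projS -/(P m) -/(e m) (IH (ltnW mn)) -addrA -opprD; congr (_ - _).
rewrite [RHS](bigD1 (Ordinal mn)) //= addrC; congr (_ + _).
apply: eq_bigl => k; rewrite ltnS [in RHS]leq_eqVlt -val_eqE /=.
by case: ltngtP.
Qed.

(** Both matrices fix the common kernel of the first [m] covectors and vanish
    on the span of their gradients; these spaces are transverse because a
    vector in both is orthogonal to itself. *)
Lemma gs_projE m : (m <= n)%N ->
  proj_mx (kermx (D m)^T) <<D m *m invmx G>>%MS = P m.
Proof.
move=> mn; have Gu := posdef_unitmx; have [[PG PP Pd sub] _] := gs_invariants mn.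
have cap0 : (kermx (D m)^T :&: <<D m *m invmx G>> = 0)%MS.
  apply/eqP; rewrite -submx0; apply/rV_subP => v.
  rewrite sub_capmx genmxE => /andP[/sub_kermxP vD /submxP[c vE]].
  rewrite submx0; apply: contraT => /G_pos.
  rewrite {2}vE !trmx_mul trmx_inv G_sym -!mulmxA mulKVmx //.
  by rewrite mulmxA vD mul0mx mxE ltxx.
have Pker : (P m <= kermx (D m)^T)%MS.
  apply/sub_kermxP; apply/matrixP => i j; rewrite [RHS]mxE.
  have := congr1 (fun A : 'M[R]_(n, 1) => A i 0) (Pd j (ltn_ord j)).
  by rewrite !mxE => E; rewrite -[RHS]E; apply: eq_bigr => k _; rewrite !mxE.
rewrite -[LHS]mul1mx -[1%:M](subrK (P m)) mulmxDl.
by rewrite proj_mx_0 ?genmxE // proj_mx_id // add0r.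
Qed.

End GramSchmidt.

(** * Moving frames and scalar curvature *)

Section MovingFrame.
Context {R : realType} {n : nat}.
Variables (U : set 'rV[R]_n) (g : 'rV[R]_n -> 'M[R]_n).
Hypotheses (oU : open U) (gC : forall i j, Ck 2 U (fun y => g y i j))
  (gS : forall y, U y -> (g y)^T = g y) (gU : forall y, U y -> g y \in unitmx).
Variable e : 'I_n -> 'rV[R]_n -> 'rV[R]_n.
Hypotheses (eC : forall k, CkV 2 U (e k))
  (e_on : forall y, U y -> forall i j, inner (g y) (e i y) (e j y) = (i == j)%:R).

Definition conn i j k y : R := inner (g y) (e i y *m nabla g (e j) y) (e k y).

(** The sum of the accelerations nabla_{e_k} e_k, in components; the i-th one is
    also the negative divergence of e_i ([div_frame]). *)
Definition frame_accel i y : R := \sum_k conn k k i y.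

Let de k j y : U y -> differentiable (fun z => e k z 0 j) y.
Proof. by move=> Uy; exact: Ck1_differentiable (eC k j) Uy. Qed.

Lemma conn_C1 i j k : Ck 1 U (conn i j k).
Proof.
have eC1 l b : Ck 1 U (fun y => e l y 0 b) by apply: Ck_le (eC l b).
have H a b : Ck 1 U (fun y => (e i y *m nabla g (e j) y) a b).
  apply: (Ck_mulmx oU _ (nabla_C1 oU gC gU (eC j))) => c l.
  by rewrite (ord1 c).
have H2 a b : Ck 1 U (fun y => (e i y *m nabla g (e j) y *m g y) a b).
  by apply: (Ck_mulmx oU H) => c l; apply: Ck_le (gC c l).
apply: (Ck_mulmx oU H2) => a b.
by apply: eq_Ck (eC1 k a) => // y _; rewrite (ord1 b) mxE.
Qed.

Let dconn i j k y : U y -> differentiable (conn i j k) y.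
Proof. by move=> Uy; exact: Ck1_differentiable (conn_C1 i j k) Uy. Qed.

(** The frame is orthonormal and the metric parallel. *)
Lemma conn_skew i j k y : U y -> conn i j k y = - conn i k j y.
Proof.
move=> Uy; apply/eqP; rewrite -subr_eq0 opprK /conn.
rewrite (innerC _ (e j y)); last exact: gS.
rewrite -(dd_inner oU gC gS gU) //; try by move=> l; exact: de.
rewrite (@eq_dd _ _ U _ _ (fun=> (j == k)%:R)) ?dd_cst //.
by move=> z Uz; exact: e_on.
Qed.

Lemma conn_expand i j y : U y ->
  e i y *m nabla g (e j) y = \sum_k conn i j k y *: e k y.
Proof. by move=> Uy; exact: (orthonormal_expand (e_on Uy)). Qed.

(** The connection is torsion free: the Hessian terms of [dd_dd] cancel. *)
Lemma frame_commutator i j f y : U y -> Ck 2 U f ->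
  dd (e i y) (fun z => dd (e j z) f z) y - dd (e j y) (fun z => dd (e i z) f z) y =
  \sum_k (conn i j k y - conn j i k y) * dd (e k y) f y.
Proof.
move=> Uy fC; rewrite !(dd_dd g _ Uy fC) //; try by move=> l; exact: de.
have -> : (e j y *m hessian g f y *m (e i y)^T) 0 0 =
          (e i y *m hessian g f y *m (e j y)^T) 0 0.
  by rewrite -trmx00 !trmx_mul trmxK (hessian_sym oU gS) // mulmxA.
have cancel (a b c : R) : (a + b) - (a + c) = b - c by ring.
rewrite cancel !conn_expand // !dd_suml -sumrB.
by apply: eq_bigr => k _; rewrite !ddZl mulrBl.
Qed.

Lemma laplacian_frame f y : U y -> Ck 2 U f ->
  \sum_k dd (e k y) (fun z => dd (e k z) f z) y =
  laplacian g f y + \sum_i frame_accel i y * dd (e i y) f y.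
Proof.
move=> Uy fC.
rewrite (laplacian_tr oU gS) // (orthonormal_trace_invmx (e_on Uy)) ?gU //.
have -> : \sum_i frame_accel i y * dd (e i y) f y =
          \sum_k dd (e k y *m nabla g (e k) y) f y.
  under eq_bigr do rewrite mulr_suml.
  rewrite exchange_big; apply: eq_bigr => k _; rewrite conn_expand // dd_suml.
  by apply: eq_bigr => i _; rewrite ddZl.
rewrite -big_split; apply: eq_bigr => k _.
by rewrite (dd_dd g _ Uy fC) // => l; exact: de.
Qed.

Lemma div_frame k y : U y -> \tr (nabla g (e k) y) = - frame_accel k y.
Proof.
move=> Uy; rewrite (orthonormal_trace (e_on Uy)) -sumrN.
by apply: eq_bigr => i _; rewrite -[LHS]/(conn i k i y) conn_skew.
Qed.

Lemma div_scale_frame k (f : 'rV[R]_n -> R) y : U y -> differentiable f y ->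
  \tr (nabla g (fun z => f z *: e k z) y) = dd (e k y) f y - f y * frame_accel k y.
Proof.
move=> Uy df; rewrite nablaZ //; last by move=> j; exact: de.
by rewrite mxtraceD mxtraceZ div_frame // mulrN mxtrace_mulC trace_mx11.
Qed.

(** The Bochner identities of the frame fields, summed: their Ricci terms
    add up to the scalar curvature, and both kinds of divergence terms are
    derivatives of [frame_accel]. *)
Lemma scalar_curvature_frame x : U x ->
  2 * \sum_i dd (e i x) (frame_accel i) x - \sum_i frame_accel i x ^+ 2 =
  scalar_curvature g x + \sum_i \sum_j \sum_k conn i j k x * conn j i k x.
Proof.
move=> Ux.
have dA i : differentiable (frame_accel i) x.
  by apply: differentiable_bigsum => k; exact: dconn.
have dN k i j : differentiable (fun y => nabla g (e k) y i j) x.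
  by apply: Ck1_differentiable (nabla_C1 oU gC gU (eC k) i j) Ux.
have sumB : \sum_k (\tr (nabla g (fun y => e k y *m nabla g (e k) y) x)
    - dd (e k x) (fun y => \tr (nabla g (e k) y)) x) =
  \sum_k ((e k x *m ricci_mx g x *m (e k x)^T) 0 0
          + \tr (nabla g (e k) x *m nabla g (e k) x)).
  by apply: eq_bigr => k _; rewrite (bochner oU gC gS gU).
have inv_sym i j : invmx (g x) i j = invmx (g x) j i.
  by rewrite -{1}(gS Ux) -trmx_inv mxE.
have Ric : \sum_k (e k x *m ricci_mx g x *m (e k x)^T) 0 0 = scalar_curvature g x.
  rewrite -(orthonormal_trace_invmx (e_on Ux)) ?gU //.
  rewrite /scalar_curvature exchange_big.
  apply: eq_bigr => i _; rewrite mxE; apply: eq_bigr => j _.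
  by rewrite [in RHS]inv_sym mxE.
have S1 : \sum_k \tr (nabla g (e k) x *m nabla g (e k) x) =
    \sum_i \sum_j \sum_k conn i j k x * conn j i k x.
  rewrite [RHS](eq_bigr _ (fun i _ => exchange_big _ _ _ _ _ _)) /=.
  rewrite [RHS]exchange_big; apply: eq_bigr => k _.
  rewrite (orthonormal_trace (e_on Ux)); apply: eq_bigr => i _.
  rewrite mulmxA conn_expand // mulmx_suml inner_suml; apply: eq_bigr => j _.
  rewrite -scalemxAl innerZl -[inner _ _ _]/(conn j k i x).
  by rewrite (conn_skew i j k) // (conn_skew j i k) // mulrNN.
have E1 : \sum_k \tr (nabla g (fun y => e k y *m nabla g (e k) y) x) =
    \sum_i dd (e i x) (frame_accel i) x - \sum_i frame_accel i x ^+ 2.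
  rewrite -linear_sum -nabla_sum /=; last first.
    move=> k j; rewrite (_ : (fun y => _) =
      (fun y => \sum_i e k y 0 i * nabla g (e k) y i j)).
      by apply: differentiable_bigsum => i; apply: differentiableM; [exact: de|].
    by apply/funext => y; rewrite mxE.
  rewrite (@eq_nabla _ _ U _ _ (fun y => \sum_i frame_accel i y *: e i y)) //.
    rewrite nabla_sum; last first.
      move=> i j; rewrite (_ : (fun y => _) = (fun y => frame_accel i y * e i y 0 j)).
        by apply: differentiableM; [|exact: de].
      by apply/funext => y; rewrite mxE.
    rewrite linear_sum -sumrB; apply: eq_bigr => i _ /=.
    by rewrite div_scale_frame // expr2.
  move=> y Uy; rewrite /frame_accel.
  under [RHS]eq_bigr do rewrite scaler_suml.
  by rewrite exchange_big; apply: eq_bigr => k _; exact: conn_expand.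
have E2 : \sum_k dd (e k x) (fun y => \tr (nabla g (e k) y)) x =
    - \sum_i dd (e i x) (frame_accel i) x.
  rewrite -sumrN; apply: eq_bigr => k _.
  rewrite (@eq_dd _ _ U _ _ (fun y => (-1) * frame_accel k y)) //.
    rewrite (@ddM _ _ _ (fun=> -1)); [|exact: differentiable_cst|exact: dA].
    by rewrite dd_cst mul0r add0r mulN1r.
  by move=> y Uy; rewrite mulN1r div_frame.
by move: sumB; rewrite sumrB big_split Ric S1 E1 E2 /= => <-; ring.
Qed.

Section Weight.
Variable w : 'rV[R]_n -> R.
Hypotheses (wC : Ck 2 U w)
  (ew : forall i y, U y -> dd (e i y) w y = w y * frame_accel i y).

(** The hypothesis [ew] says that all the fields [w e_i] are divergence free.
    Differentiated once more along e_i and summed, it turns [laplacian_frame]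
    into laplacian w = w sum_i e_i A_i with A = [frame_accel], and
    [scalar_curvature_frame] expresses that sum by the curvature. *)
Lemma laplacian_weight x : U x ->
  2 * laplacian g w x = w x * (scalar_curvature g x
    + \sum_i \sum_j \sum_k conn i j k x * conn j i k x
    + \sum_i frame_accel i x ^+ 2).
Proof.
move=> Ux.
have dA i : differentiable (frame_accel i) x.
  by apply: differentiable_bigsum => k; exact: dconn.
have dw : differentiable w x by exact: Ck1_differentiable wC Ux.
rewrite -scalar_curvature_frame // subrK mulrCA; congr (_ * _).
have := laplacian_frame Ux wC.
have -> : \sum_k dd (e k x) (fun z => dd (e k z) w z) x =
    \sum_i w x * frame_accel i x ^+ 2 + w x * \sum_i dd (e i x) (frame_accel i) x.
  rewrite mulr_sumr -big_split; apply: eq_bigr => i _.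
  rewrite (@eq_dd _ _ U _ _ (fun y => w y * frame_accel i y)) //; last first.
    by move=> y; exact: ew.
  by rewrite ddM // ew //=; ring.
have -> : \sum_i frame_accel i x * dd (e i x) w x = \sum_i w x * frame_accel i x ^+ 2.
  by apply: eq_bigr => i _; rewrite ew //; ring.
by move=> E; apply: (addrI (\sum_i w x * frame_accel i x ^+ 2)); rewrite E addrC.
Qed.

Lemma sqnorm_nabla_weight o x : U x ->
  sqnorm11 (g x) (nabla g (fun y => w y *: e o y) x) =
  w x ^+ 2 * (\sum_i frame_accel i x ^+ 2 + \sum_i \sum_k conn i o k x ^+ 2).
Proof.
move=> Ux; have dw : differentiable w x by exact: Ck1_differentiable wC Ux.
rewrite /sqnorm11 -!mulmxA (orthonormal_trace_invmx (e_on Ux)) ?gU //.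
rewrite -big_split mulr_sumr; apply: eq_bigr => i _ /=.
set N := nabla g _ x.
have -> : (e i x *m (N *m (g x *m N^T)) *m (e i x)^T) 0 0 =
          inner (g x) (e i x *m N) (e i x *m N).
  by rewrite /inner trmx_mul !mulmxA.
rewrite (orthonormal_parseval (e_on Ux)).
have coef k : inner (g x) (e i x *m N) (e k x) =
    w x * ((if k == o then frame_accel i x else 0) + conn i o k x).
  rewrite /N nablaZ //; last by move=> j; exact: de.
  rewrite mulmxDr innerDl -scalemxAr innerZl mulmxA [e i x *m _]mx11_scalar.
  rewrite mul_scalar_mx innerZl e_on // -[(_ *m _) 0 0]/(dd (e i x) w x) ew //.
  by rewrite /conn (eq_sym k o); case: (o == k) => /=; ring.
have conn0 : conn i o o x = 0 by have := conn_skew i o o Ux; lra.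
transitivity (w x ^+ 2 * \sum_k ((if k == o then frame_accel i x ^+ 2 else 0)
    + conn i o k x ^+ 2)).
  rewrite mulr_sumr; apply: eq_bigr => k _.
  rewrite (innerC (e k x)); last exact: gS.
  rewrite coef; case: eqP => [->|_]; first by rewrite conn0; ring.
  by ring.
by rewrite big_split /= -big_mkcond big_pred1_eq.
Qed.

(** By the two previous identities the difference of the two sides is [w x]
    times the defect of [flag_sum_ge]. *)
Lemma frame_inequality (o : 'I_n) x : U x -> 0 < w x -> o = 0%N :> nat ->
  (forall i j m : 'I_n, (m < i)%N -> (m < j)%N -> conn i j m x = conn j i m x) ->
  sqnorm11 (g x) (nabla g (fun y => w y *: e o y) x) / w x
    + scalar_curvature g x * w x <= 2 * laplacian g w x.
Proof.
move=> Ux w0 o0 flag.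
have S := flag_sum_ge (fun i j k => conn_skew i j k Ux) flag o0.
rewrite laplacian_weight // sqnorm_nabla_weight // expr2 mulrAC.
rewrite -[w x * w x / w x]mulrA mulfV ?gt_eqF // mulr1.
by rewrite [scalar_curvature g x * _]mulrC -mulrDr ler_pM2l //; lra.
Qed.

End Weight.
End MovingFrame.

(** * The frame adapted to a flag of level sets *)

Section GradientFrame.
Context {R : realType} {n : nat}.
Variables (U : set 'rV[R]_n) (g : 'rV[R]_n -> 'M[R]_n).
Hypotheses (oU : open U) (gC : forall i j, Ck 2 U (fun y => g y i j))
  (gS : forall y, U y -> (g y)^T = g y)
  (g_pos : forall y (v : 'rV[R]_n), U y -> v != 0 -> 0 < (v *m g y *m v^T) 0 0).
Variable f : nat -> 'rV[R]_n -> R.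
Hypotheses (fC : forall m, (m < n)%N -> Ck 3 U (f m))
  (df_free : forall y, U y -> row_free (dU f n y)).

Let gU y : U y -> g y \in unitmx.
Proof. by move=> Uy; apply: posdef_unitmx => v; exact: g_pos. Qed.

Definition grad_proj m y := gs_proj (g y) (fun j => dform (f j) y) m.
Definition grad_vec m y := gs_vec (g y) (fun j => dform (f j) y) m.
Definition grad_frame m y := gs_frame (g y) (fun j => dform (f j) y) m.

(** The length of the gradient of [f m] along the common level sets of the
    previous functions. *)
Definition grad_len m y := vnorm (g y) (grad_vec m y).

Let e (k : 'I_n) := grad_frame k.

Lemma grad_len_gt0 m y : (m < n)%N -> U y -> 0 < grad_len m y.
Proof.
by move=> mn Uy; apply: gs_vec_gt0 => //; [exact: gS|move=> v; exact: g_pos|exact: df_free].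
Qed.

Lemma grad_frame_orthonormal y : U y ->
  forall i j, inner (g y) (e i y) (e j y) = (i == j)%:R.
Proof.
move=> Uy i j; apply: gs_frame_orthonormal; [exact: gS|by move=> v; exact: g_pos|].
exact: df_free.
Qed.

Let step_C2 m : (m < n)%N -> (forall a b, Ck 2 U (fun y => grad_proj m y a b)) ->
  Ck 2 U (grad_len m) /\ CkV 2 U (grad_frame m).
Proof.
move=> mn PC.
have dC a b : Ck 2 U (fun y => dform (f m) y a b).
  by apply: eq_Ck (Ck_pd b (fC mn)) => // y _; rewrite mxE.
have idC a b : Ck 2 U (fun y => (dform (f m) y *m invmx (g y)) a b).
  exact: Ck_mulmx oU dC (Ck_invmx oU gU gC) a b.
have vC a b : Ck 2 U (fun y => grad_vec m y a b).
  exact: Ck_mulmx oU idC PC a b.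
have vTC a b : Ck 2 U (fun y => (grad_vec m y)^T a b).
  by apply: eq_Ck (vC b a) => // y _; rewrite [RHS]mxE.
have sC : Ck 2 U (grad_len m).
  apply: Ck_sqrt => //; last first.
    exact: Ck_mulmx oU (Ck_mulmx oU vC gC) vTC 0 0.
  by move=> y Uy; have := grad_len_gt0 mn Uy; rewrite /grad_len sqrtr_gt0.
split; first exact: sC.
move=> b.
have siC : Ck 2 U (fun y => (grad_len m y)^-1).
  by apply: (Ck_inv oU _ sC) => y Uy; rewrite gt_eqF // grad_len_gt0.
apply: (eq_Ck oU _ (Ck_mul oU siC (vC 0 b))) => y _.
by rewrite [RHS]mxE.
Qed.

Let grad_proj_C2 m : (m <= n)%N -> forall a b, Ck 2 U (fun y => grad_proj m y a b).
Proof.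
elim: m => [|m IH] mn a b; first exact: Ck_cst.
have PC := IH (ltnW mn); have [_ eC] := step_C2 mn PC.
apply: (@eq_Ck _ _ _ _ (fun y => grad_proj m y a b
    - (g y *m (grad_frame m y)^T *m grad_frame m y) a b)) => //.
  by move=> y _; rewrite /grad_proj gs_projS [RHS]mxE [X in _ = _ + X]mxE.
have eTC c l : Ck 2 U (fun y => (grad_frame m y)^T c l).
  by apply: eq_Ck (eC c) => // y _; rewrite (ord1 l) [RHS]mxE.
have eC' c l : Ck 2 U (fun y => grad_frame m y c l).
  by apply: eq_Ck (eC l) => // y _; rewrite (ord1 c).
apply: (Ck_sub oU (PC a b)).
exact: Ck_mulmx oU (Ck_mulmx oU gC eTC) eC' a b.
Qed.

Lemma grad_len_C2 m : (m < n)%N -> Ck 2 U (grad_len m).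
Proof. by move=> mn; have [] := step_C2 mn (grad_proj_C2 (ltnW mn)). Qed.

Lemma grad_frame_C2 (k : 'I_n) : CkV 2 U (e k).
Proof.
by have [] := step_C2 (ltn_ord k) (grad_proj_C2 (ltnW (ltn_ord k))).
Qed.

Lemma dd_grad_frame0 m (k : 'I_n) y : U y -> (m < k)%N -> dd (e k y) (f m) y = 0.
Proof.
move=> Uy mk; rewrite /dd (gs_frame_dual0 _ _ _ mk) ?mxE //.
- exact: gS.
- by move=> v; exact: g_pos.
- exact: df_free.
Qed.

Lemma dd_grad_frame (k : 'I_n) y : U y -> dd (e k y) (f k) y = grad_len k y.
Proof.
move=> Uy; rewrite /dd gs_frame_dual //.
- exact: gS.
- by move=> v; exact: g_pos.
- exact: df_free.
Qed.

Let cn := conn g e.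

Let comm i j (m : 'I_n) y : U y ->
  dd (e i y) (fun z => dd (e j z) (f m) z) y
  - dd (e j y) (fun z => dd (e i z) (f m) z) y =
  \sum_k (cn i j k y - cn j i k y) * dd (e k y) (f m) y.
Proof.
move=> Uy; have fC2 : Ck 2 U (f m) by exact: Ck_pred (fC (ltn_ord m)).
exact: (frame_commutator oU gS grad_frame_C2 grad_frame_orthonormal).
Qed.

(** The second fundamental form of the common level sets of f_0, ..., f_m is
    symmetric. Brackets of fields tangent to them annihilate f_0, ..., f_m,
    and the matrix of the derivatives [e_k f_m] is triangular. *)
Lemma conn_flag (i j m : 'I_n) y : U y -> (m < i)%N -> (m < j)%N ->
  cn i j m y = cn j i m y.
Proof.
move=> Uy; have [k] := ubnP (m : nat); elim: k m => // k IH m mk mi mj.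
have := comm i j m Uy.
rewrite (@eq_dd _ _ U _ _ (fun=> 0)) ?dd_cst //; last first.
  by move=> z Uz; exact: dd_grad_frame0.
rewrite (@eq_dd _ _ U _ _ (fun=> 0)) ?dd_cst ?subr0 //; last first.
  by move=> z Uz; exact: dd_grad_frame0.
rewrite (bigD1 m) //= big1 ?addr0 => [|l lm].
  rewrite dd_grad_frame // => /esym/eqP; rewrite mulf_eq0 subr_eq0.
  by rewrite [_ == 0 :> R]gt_eqF ?grad_len_gt0 // orbF => /eqP.
case: (ltngtP l m) => [ltlm|ml|/val_inj lmE]; last by rewrite lmE eqxx in lm.
- rewrite (IH l) ?subrr ?mul0r //; first exact: leq_trans ltlm mk.
    exact: ltn_trans ltlm mi.
  exact: ltn_trans ltlm mj.
- by rewrite dd_grad_frame0 // mulr0.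
Qed.

Let skew i j k y : U y -> cn i j k y = - cn i k j y.
Proof.
by move=> Uy; exact: (conn_skew oU gC gS gU grad_frame_C2 grad_frame_orthonormal).
Qed.

Let cn_diag i j y : U y -> cn i j j y = 0.
Proof. by move=> Uy; have := skew i j j Uy; lra. Qed.

(** Apply the bracket of e_m and e_i to f_m. Geometrically, the curvature of the
    integral curves of e_m within Sigma_m is the logarithmic gradient of
    [grad_len m]. *)
Lemma dd_grad_len (m i : 'I_n) y : U y -> (m < i)%N ->
  dd (e i y) (grad_len m) y = cn m m i y * grad_len m y.
Proof.
move=> Uy mi; have := comm m i m Uy.
rewrite (@eq_dd _ _ U _ _ (fun=> 0)) ?dd_cst //; last first.
  by move=> z Uz; exact: dd_grad_frame0.
rewrite (@eq_dd _ _ U (e i y) _ (grad_len m)) //; last first.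
  by move=> z Uz; exact: dd_grad_frame.
rewrite (bigD1 m) //= big1 ?addr0 => [|l lm].
  by rewrite dd_grad_frame // cn_diag // (skew m i m) //; lra.
case: (ltngtP l m) => [ltlm|ml|/val_inj lmE]; last by rewrite lmE eqxx in lm.
- by rewrite conn_flag ?subrr ?mul0r //; exact: ltn_trans ltlm mi.
- by rewrite dd_grad_frame0 // mulr0.
Qed.

(** The length of Z_m: the recursion Z_m = |Z_{m+1}| grad_{Sigma_m} f_m
    unrolled from |Z_{n-1}| = 1, so that the last factor has index n - 2. *)
Definition weight m y := \prod_(m <= k < n.-1) grad_len k y.

Lemma weightS m y : (m < n.-1)%N ->
  weight m y = grad_len m y * weight m.+1 y.
Proof. by move=> mn; rewrite /weight big_ltn. Qed.

Let ltn_pred_n m : (m < n.-1)%N -> (m < n)%N.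
Proof. by move=> mn; apply: leq_trans mn (leq_pred n). Qed.

Lemma weight_gt0 m y : U y -> 0 < weight m y.
Proof.
move=> Uy; rewrite /weight big_nat; apply: prodr_gt0 => k /andP[_ kn].
by apply: grad_len_gt0 => //; exact: ltn_pred_n.
Qed.

Lemma weight_C2 m : Ck 2 U (weight m).
Proof.
apply: (@eq_Ck _ _ _ _ (fun y =>
  \prod_(m <= k < n.-1 | (m <= k < n.-1)%N) grad_len k y)) => //.
  by move=> y _; rewrite /weight -big_nat.
by apply: Ck_prod => // k /andP[_ kn]; apply: grad_len_C2; exact: ltn_pred_n.
Qed.

Hypothesis div0 : forall m y, (m < n.-1)%N -> U y ->
  \tr (grad_proj m y *m nabla g (fun z => weight m z *: grad_frame m z) y) = 0.

Let de (k j : 'I_n) y : U y -> differentiable (fun z => e k z 0 j) y.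
Proof. by move=> Uy; exact: Ck1_differentiable (grad_frame_C2 k j) Uy. Qed.

Lemma trace_grad_proj m y (N : 'M[R]_n) : (m <= n)%N -> U y ->
  \tr (grad_proj m y *m N) =
  \sum_(k < n | (m <= k)%N) inner (g y) (e k y *m N) (e k y).
Proof.
move=> mn Uy; rewrite /grad_proj (gs_proj_frame _ _ mn) mulmxBl mul1mx linearB /=.
apply/eqP; rewrite subr_eq; apply/eqP.
rewrite (orthonormal_trace (grad_frame_orthonormal Uy)).
rewrite (bigID (fun k : 'I_n => (k < m)%N)) /= addrC; congr (_ + _).
  by apply: eq_bigl => k; rewrite -leqNgt.
rewrite mulmx_suml linear_sum; apply: eq_bigr => k _ /=.
by rewrite -(mulmxA _ _ N) mxtrace_mulC mulmxA trace_mx11.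
Qed.

Let dd_weight_diag (m : 'I_n) y : U y -> (m < n.-1)%N ->
  dd (e m y) (weight m) y = weight m y * \sum_(k < n | (m <= k)%N) cn k k m y.
Proof.
move=> Uy mn; have dw : differentiable (weight m) y.
  exact: Ck1_differentiable (weight_C2 m) Uy.
have := div0 mn Uy; rewrite trace_grad_proj ?(ltnW (ltn_ord m)) //.
have E k : inner (g y)
    (e k y *m nabla g (fun z => weight m z *: grad_frame m z) y) (e k y) =
    dd (e k y) (weight m) y * (m == k)%:R - weight m y * cn k k m y.
  rewrite (nablaZ g dw); last by move=> j; exact: de.
  rewrite mulmxDr innerDl -(scalemxAr (weight m y)) innerZl mulmxA [e k y *m _]mx11_scalar.
  rewrite mul_scalar_mx innerZl -[(_ *m _) 0 0]/(dd (e k y) (weight m) y).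
  rewrite (grad_frame_orthonormal Uy m k) -[inner _ _ _]/(cn k m k y).
  by rewrite skew // mulrN.
rewrite (eq_bigr _ (fun k _ => E k)) sumrB (bigD1 m) //= eqxx mulr1.
rewrite [X in _ + X - _]big1 => [|k /andP[_ km]]; last first.
  by rewrite eq_sym (negbTE km) mulr0.
by rewrite addr0 -mulr_sumr => /eqP; rewrite subr_eq0 => /eqP.
Qed.

(** Descending induction on [m]. Along e_m the derivative is given by the
    vanishing of the divergence of Z_m; for i > m the factor [grad_len m]
    contributes the term k = m and the other factor the terms k > m. *)
Lemma dd_weight m (i : 'I_n) y : (m <= n.-1)%N -> (m <= i)%N -> U y ->
  dd (e i y) (weight m) y = weight m y * \sum_(k < n | (m <= k)%N) cn k k i y.
Proof.
move=> mn; have [l] := ubnP (n.-1 - m)%N.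
elim: l m mn i => // l IH m; rewrite leq_eqVlt => /orP[/eqP mE|mn] i lm mi Uy.
  rewrite (@eq_dd _ _ U _ _ (fun=> 1)) //; last first.
    by move=> z _; rewrite /weight mE big_geq.
  rewrite dd_cst big1 ?mulr0 // => k mk.
  have -> : k = i; last by rewrite cn_diag.
  have le_pred (j : 'I_n) : (m <= j)%N -> j = m :> nat.
    move=> mj; apply/eqP; rewrite eqn_leq mj andbT mE.
    by rewrite -ltnS (ltn_predK (ltn_ord j)).
  by apply: val_inj; exact: etrans (le_pred k mk) (esym (le_pred i mi)).
have mn' := ltn_pred_n mn; pose m' := Ordinal mn'.
move: mi; rewrite leq_eqVlt => /orP[/eqP mi|mi].
  have -> : i = m' by apply: val_inj.
  exact: dd_weight_diag.
have dlen : differentiable (grad_len m) y.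
  exact: Ck1_differentiable (grad_len_C2 mn') Uy.
have dw : differentiable (weight m.+1) y.
  exact: Ck1_differentiable (weight_C2 m.+1) Uy.
rewrite (@eq_dd _ _ U _ _ (fun z => grad_len m z * weight m.+1 z)) //; last first.
  by move=> z _; rewrite weightS.
rewrite ddM // (@dd_grad_len m' i) // IH //; last first.
  by rewrite -ltnS (leq_trans _ lm) // ltnS ltn_sub2l.
rewrite (weightS y mn) [in RHS](bigD1 m') //=.
rewrite [X in _ = _ * (_ + X)](eq_bigl (fun k : 'I_n => (m < k)%N)); first by ring.
by move=> k; rewrite [in RHS]ltn_neqAle andbC -val_eqE /= eq_sym.
Qed.

Lemma gradient_frame_inequality (o : 'I_n) x : U x -> o = 0%N :> nat ->
  sqnorm11 (g x) (nabla g (fun y => weight 0 y *: grad_frame 0 y) x) / weight 0 x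
    + scalar_curvature g x * weight 0 x <= 2 * laplacian g (weight 0) x.
Proof.
move=> Ux o0.
have := @frame_inequality _ _ U g oU gC gS gU e grad_frame_C2 grad_frame_orthonormal
  (weight 0) (weight_C2 0) _ o x Ux (weight_gt0 0 Ux) o0 _.
rewrite /e o0; apply.
  by move=> i y Uy; rewrite dd_weight.
by move=> i j m mi mj; exact: conn_flag.
Qed.

End GradientFrame.

(** * From the manifold to a frame in a chart *)

Section Coordinate.
Context {R : realType} {n : nat}.

Lemma derive_coord (i0 : 'I_n) (v x : 'rV[R]_n) :
  'D_v (fun y : 'rV[R]_n => y 0 i0) x = v 0 i0.
Proof.
rewrite deriveE; last exact: differentiable_coord.
have lin : linear (fun y : 'rV[R]_n => y 0 i0 : R) by move=> a y z; rewrite !mxE.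
pose linM := GRing.isLinear.Build _ _ _ _ _ lin.
pose L : {linear 'rV[R]_n -> R} := HB.pack (fun y : 'rV[R]_n => y 0 i0) linM.
by rewrite -[fun y => _]/(L : _ -> _) diff_lin //; exact: coord_continuous.
Qed.

Lemma Ck_coord k (U : set 'rV[R]_n) (i0 : 'I_n) : open U ->
  Ck k U (fun y => y 0 i0).
Proof.
move=> oU; case: k => [|k]; first by move=> x _; exact: coord_continuous.
split=> [x _|i]; first exact: differentiable_coord.
apply: eq_Ck (Ck_cst k (delta_mx (0 : 'I_1) i 0 i0) oU) => // x _.
by rewrite /pd derive_coord.
Qed.

Lemma dform_coord (i0 : 'I_n) (x : 'rV[R]_n) :
  dform (fun y : 'rV[R]_n => y 0 i0) x = delta_mx 0 i0.
Proof. by apply/rowP => i; rewrite mxE /pd derive_coord !mxE !eqxx eq_sym. Qed.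

Lemma wedge_row_free k (A V : 'M[R]_(k, n)) : wedge A V != 0 -> row_free A.
Proof.
rewrite /wedge -unitfE -unitmxE => AVu; apply/row_freeP.
by exists (V^T *m invmx (A *m V^T)); rewrite mulmxA mulmxV.
Qed.

Lemma exists_delta_notin m (A : 'M[R]_(m, n)) : (m < n)%N ->
  exists i0, ~~ (delta_mx (0 : 'I_1) i0 <= A)%MS.
Proof.
move=> mn; apply/existsP; apply: contraLR mn; rewrite negb_exists -leqNgt.
move=> /forallP dA; apply: leq_trans (rank_leq_row A).
rewrite -[X in (X <= _)%N](mxrank1 R) mxrankS //; apply/row_subP => i.
by rewrite row1; have := dA i; rewrite negbK.
Qed.

Lemma row_free_dU (f : nat -> 'rV[R]_n -> R) x :
  (0 < n)%N -> row_free (dU f (n - 1) x) ->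
  ~~ (dform (f (n - 1)%N) x <= dU f (n - 1) x)%MS -> row_free (dU f n x).
Proof.
move=> n0 freeA dA.
have row_in (j : nat) : (j < n)%N -> (dform (f j) x <= dU f n x)%MS.
  move=> jn; have -> : dform (f j) x = row (Ordinal jn) (dU f n x).
    by rewrite rowK.
  exact: row_sub.
have sub : (dU f (n - 1) x < dU f n x)%MS.
  rewrite /ltmx; apply/andP; split.
    apply/row_subP => j; rewrite rowK row_in //.
    exact: leq_trans (ltn_ord j) (leq_subr _ _).
  apply: contra dA; apply: submx_trans; apply: row_in.
  by rewrite subn1 prednK.
have := rank_ltmx sub; rewrite (eqP freeA) subn1 prednK // => nle.
by rewrite /row_free eqn_leq rank_leq_row.
Qed.

End Coordinate.

Section Transfer.
Context {R : realType} {n : nat}.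
Variables (U : set 'rV[R]_n) (g : 'rV[R]_n -> 'M[R]_n).
Hypothesis oU : open U.

Lemma eq_laplacian f h x : (forall y, U y -> f y = h y) -> U x ->
  laplacian g f x = laplacian g h x.
Proof.
move=> fh Ux; rewrite /laplacian; apply: eq_bigr => i _; apply: eq_bigr => j _.
have -> : pd i (pd j f) x = pd i (pd j h) x.
  by apply: (eq_pd i oU _ Ux) => y; exact: eq_pd.
by under eq_bigr do rewrite (eq_pd _ oU fh Ux).
Qed.

Lemma eq_projS (u f : nat -> 'rV[R]_n -> R) m x :
  (forall j, (j < m)%N -> u j = f j) -> projS g u m x = projS g f m x.
Proof.
move=> uf; have uE : dU u m x = dU f m x.
  by apply/row_matrixP => j; rewrite !rowK uf.
by rewrite /projS /tangentS /normalS uE.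
Qed.

End Transfer.

Theorem theorem1p4 (R : realType) (n : nat) (hn : (2 <= n)%N)
  (M : manifold R n) (g : metric M)
  (u : nat -> M -> R) (Z : nat -> vector_field M)
  (uC3 : forall m, (m <= n - 2)%N -> CkM 3 (u m))
  (du_neq0 : forall a x, cod (atlas a) x ->
     exists V : 'M[R]_(n - 1, n),
       wedge (dU (fun j => in_chart a (u j)) (n - 1) x) V != 0)
  (Z_def : forall m, (m <= n - 2)%N -> forall a x, cod (atlas a) x ->
     (vnorm (g a x) (Z m.+1 a x))^-1 *: Z m a x =
     gradS (g a) (fun j => in_chart a (u j)) m (in_chart a (u m)) x)
  (Z_last : forall a x, cod (atlas a) x ->
     vnorm (g a x) (Z (n - 1)%N a x) = 1)
  (Z_div : forall m, (m <= n - 2)%N -> forall a x, cod (atlas a) x ->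
     divS (g a) (fun j => in_chart a (u j)) m (Z m a) x = 0) :
  forall (p : M) (a : chart_index M), dom (atlas a) p ->
    let x := phi (atlas a) p in
    let lenZ0 := fun y => vnorm (g a y) (Z 0%N a y) in
    2 * laplacian (g a) lenZ0 x >=
      sqnorm11 (g a x) (nabla (g a) (Z 0%N a) x) / lenZ0 x
      + scalar_curvature (g a) x * lenZ0 x.
Proof.
move=> p a dp.
pose x := phi (atlas a) p; pose lenZ0 y := vnorm (g a y) (Z 0%N a y).
change (sqnorm11 (g a x) (nabla (g a) (Z 0%N a) x) / lenZ0 x
  + scalar_curvature (g a) x * lenZ0 x <= 2 * laplacian (g a) lenZ0 x).
have cx : cod (atlas a) x by exact: phi_cod.
have oC : open (cod (atlas a)) by exact: open_cod.
have n0 : (0 < n)%N by exact: leq_trans hn.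
have n1n : (n - 1 < n)%N by rewrite subn1 prednK.
have ltn1E m : (m < n - 1)%N = (m <= n - 2)%N.
  by rewrite -(subnSK hn) ltnS.
pose v j := in_chart a (u j).
have free_v y : cod (atlas a) y -> row_free (dU v (n - 1) y).
  by move=> cy; have [V] := du_neq0 a y cy; exact: wedge_row_free.
(* A frame of the whole tangent space needs one function more; a coordinate
   whose differential at x is independent of those of the u_j will do. *)
have [i0 di0] := exists_delta_notin (dU v (n - 1) x) n1n.
pose f j : 'rV[R]_n -> R := if (j < n - 1)%N then v j else fun y => y 0 i0.
have fE j : (j < n - 1)%N -> f j = v j by rewrite /f => ->.
have fl : f (n - 1)%N = fun y => y 0 i0 by rewrite /f ltnn.
have dUE m y : (m <= n - 1)%N -> dU f m y = dU v m y.
  move=> mn; apply/row_matrixP => j; rewrite !rowK fE //.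
  exact: leq_trans (ltn_ord j) mn.
(* Independence persists near x, on the domain U of the frame. *)
pose U := [set y | cod (atlas a) y /\ \det (dU f n y) != 0].
have UC y : U y -> cod (atlas a) y by case.
have fC3 m : (m < n)%N -> Ck 3 (cod (atlas a)) (f m).
  move=> mn; rewrite /f; case: ifP => [|_]; last exact: Ck_coord.
  by rewrite ltn1E => /uC3; exact.
have detC : Ck 0 (cod (atlas a)) (fun y => \det (dU f n y)).
  apply: Ck_mx_det => // i j.
  have : Ck 0 (cod (atlas a)) (pd j (f i)).
    by apply: Ck_le (Ck_pd j (fC3 i (ltn_ord i))).
  by apply: eq_Ck => // y _; rewrite !mxE.
have oU : open U.
  rewrite openE => y [cy dy]; rewrite /interior.
  have nc : nbhs y (cod (atlas a)) by exact: open_nbhs_nbhs.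
  exact: filterI nc (cvgr_neq0 _ (detC y cy) dy).
have Ux : U x.
  split=> //; rewrite -unitfE -unitmxE -row_free_unit.
  by apply: row_free_dU => //; rewrite ?dUE // ?fl ?dform_coord //; exact: free_v.
have df_free y : U y -> row_free (dU f n y).
  by case=> _ dy; rewrite row_free_unit unitmxE unitfE.
have gC i j : Ck 2 U (fun y => g a y i j).
  exact: (Ck_subset UC (gmx_smooth g a i j 2)).
have gS y : U y -> (g a y)^T = g a y by move=> /UC; exact: gmx_sym.
have g_pos y (z : 'rV[R]_n) : U y -> z != 0 -> 0 < (z *m g a y *m z^T) 0 0.
  by move=> /UC cy; exact: gmx_pos.
have fCU m : (m < n)%N -> Ck 3 U (f m).
  by move=> mn; exact: Ck_subset UC (fC3 m mn).
have projE m y : (m <= n - 1)%N -> U y ->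
    projS (g a) v m y = grad_proj (g a) f m y.
  move=> mn Uy; rewrite -(@eq_projS _ _ (g a) f); last first.
    by move=> j jm; rewrite fE //; exact: leq_trans jm mn.
  apply: gs_projE; [exact: gS|by move=> z; exact: g_pos|exact: df_free|].
  exact: leq_trans mn (leq_subr _ _).
have w_gt0 m y : U y -> 0 < weight (g a) f m y.
  by move=> Uy; exact: (weight_gt0 gS g_pos df_free).
have ltn_n m : (m < n - 1)%N -> (m < n)%N.
  by move=> mn; exact: leq_trans mn (leq_subr _ _).
have Z_step m y : (m < n - 1)%N -> U y ->
    vnorm (g a y) (Z m.+1 a y) = weight (g a) f m.+1 y ->
    Z m a y = weight (g a) f m y *: grad_frame (g a) f m y.
  move=> mn Uy wE; have w0 := w_gt0 m.+1 y Uy.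
  have ZE : (weight (g a) f m.+1 y)^-1 *: Z m a y = grad_vec (g a) f m y.
    have mle : (m <= n - 2)%N by rewrite -ltn1E.
    rewrite -wE (Z_def m mle a y (UC _ Uy)).
    rewrite -[LHS]/(gradS (g a) v m (v m) y) -fE //.
    by rewrite /gradS projE ?(ltnW mn).
  apply: (scalerI (invr_neq0 (lt0r_neq0 w0))).
  have mn1 : (m < n.-1)%N by rewrite -subn1.
  rewrite ZE scalerA (weightS (g a) f y mn1) mulrC mulfK ?lt0r_neq0 //.
  apply: gs_vecE; [exact: gS|by move=> z; exact: g_pos|exact: df_free|exact: ltn_n].
have lenZ m y : (m <= n - 1)%N -> U y ->
    vnorm (g a y) (Z m a y) = weight (g a) f m y.
  move=> mn Uy; have [l] := ubnP (n - 1 - m)%N.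
  elim: l m mn => // l IH m; rewrite leq_eqVlt => /orP[/eqP ->|mn] lm.
    rewrite (Z_last a y (UC _ Uy)) /weight big_geq // subn1; exact: leqnn.
  rewrite (Z_step m y mn Uy); last first.
    by apply: IH => //; rewrite -ltnS (leq_trans _ lm) // ltnS ltn_sub2l.
  have eo := grad_frame_orthonormal gS g_pos df_free Uy
    (Ordinal (ltn_n m mn)) (Ordinal (ltn_n m mn)).
  rewrite vnormZ gtr0_norm ?w_gt0 // -[RHS]mulr1; congr (_ * _).
  by rewrite /vnorm -/(inner _ _ _) eo eqxx sqrtr1.
have ZE m y : (m < n - 1)%N -> U y ->
    Z m a y = weight (g a) f m y *: grad_frame (g a) f m y.
  by move=> mn Uy; apply: Z_step => //; exact: lenZ.
have n10 : (0 < n - 1)%N by rewrite subn_gt0.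
rewrite (@eq_laplacian _ _ U _ oU lenZ0 (weight (g a) f 0)) //; last first.
  by move=> y; exact: lenZ.
rewrite (@eq_nabla _ _ U _ _
  (fun y => weight (g a) f 0 y *: grad_frame (g a) f 0 y)) //; last first.
  by move=> y; exact: ZE.
rewrite /lenZ0 lenZ //.
apply: (gradient_frame_inequality oU gC gS g_pos fCU df_free _ (o := Ordinal n0)) => //.
move=> m y; rewrite -subn1 => mn Uy.
have := Z_div m _ a y (UC _ Uy); rewrite -ltn1E => /(_ mn).
rewrite /divS /nablaS -/v projE ?(ltnW mn) //.
have [[_ PP _ _] _] := @gs_invariants _ _ _ (fun j => dform (f j) y) (gS _ Uy)
  (fun z => @g_pos y z Uy) (df_free _ Uy) _ (ltnW (ltn_n m mn)).
rewrite mulmxA mxtrace_mulC mulmxA [X in \tr (X *m _)]PP => <-.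
congr (\tr (_ *m _)); apply: esym; apply: (eq_nabla _ oU) => // z.
exact: ZE.
Qed.
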